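(* (1) $\mathsf{\Lambda}^\circ_\omega=\mathfrak c^+$. (2) $\mathsf{\Delta}_\omega^\circ\le\mathfrak c$. (3) $\mathsf{\Delta}^\circ_\omega=\mathfrak c$ implies $\mathsf{\Sigma}^\circ_{\omega_1}\le\mathsf{\Sigma}_\omega^\circ=\mathfrak c$. (4) $\mathfrak t=\mathfrak b$ implies $\mathsf{\Delta}_{\omega_1}^\circ=\mathsf{\Sigma}_{\omega_1}^\circ=\mathfrak b$. (5) $\mathfrak t=\mathfrak d$ implies $\mathsf{\Lambda}_{\omega_1}^\circ=\mathfrak d$.
   Context: An entourage on a set $X$ is a set $E\subseteq X\times X$ containing the diagonal $\Delta_X$; $E^{-1}=\{(y,x):(x,y)\in E\}$, $EF=\{(x,z):\exists y\ (x,y)\in E,(y,z)\in F\}$, $E(x)=\{y:(x,y)\in E\}$, $E[A]=\bigcup_{a\in A}E(a)$. A coarse structure on $X$ is a family $\mathcal E$ of entourages on $X$ such that $\bigcup\mathcal E=X\times X$; for any $E,F\in\mathcal E$ there is $T\in\mathcal E$ with $EF^{-1}\subseteq T$; and every entourage contained in a member of $\mathcal E$ belongs to $\mathcal E$. A base of $\mathcal E$ is a subfamily $\mathcal B\subseteq\mathcal E$ such that each $E\in\mathcal E$ is contained in some $B\in\mathcal B$; the weight $w(\mathcal E)$ is the smallest cardinality of a base; $\mathcal E$ is cellular if it has a base consisting of equivalence relations. A set $A\subseteq X$ is $\mathcal E$-bounded if $A\subseteq E(x)$ for some $E\in\mathcal E$, $x\in X$, and $\mathcal E$-unbounded otherwise;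 $\mathcal E$-discrete if for every $E\in\mathcal E$ the set $\{x\in A:A\cap E(x)\ne\{x\}\}$ is $\mathcal E$-bounded; $\mathcal E$-large if $E[A]=X$ for some $E\in\mathcal E$. Sets $A,B$ are $\mathcal E$-separated if $E[A]\cap E[B]$ is $\mathcal E$-bounded for every $E\in\mathcal E$. A coarse structure $\mathcal E$ for which $X$ is $\mathcal E$-unbounded is called indiscrete if each $\mathcal E$-discrete subset of $X$ is $\mathcal E$-bounded; inseparated if $X$ contains no $\mathcal E$-separated $\mathcal E$-unbounded sets $A,B$; large if every $\mathcal E$-unbounded set is $\mathcal E$-large. $\mathbb E_\omega$ is the set of entourages $E$ on $\omega$ with $\sup_{x\in\omega}\max\{|E(x)|,|E^{-1}(x)|\}<\omega$; $\mathbb E_{\omega_1}$ is the set of entourages $E$ on $\omega$ with $E(x)$ and $E^{-1}(x)$ finite for all $x$. For $\kappa\in\{\omega,\omega_1\}$ let $\mathsf{\Delta}^\circ_\kappa=\min(\{\mathfrak c^+\}\cup\{w(\mathcal E):\mathcal E\subseteq\mathbb E_\kappa$ is an indiscrete cellular coarse structure on $\omega\})$, $\mathsf{\Sigma}^\circ_\kappa=\min(\{\mathfrak c^+\}\cup\{w(\mathcal E):\mathcal E\subseteq\mathbb E_\kappa$ is an inseparated cellular coarse structure on $\omega\})$, $\mathsf{\Lambda}^\circ_\kappa=\min(\{\mathfrak c^+\}\cup\{w(\mathcal E):\mathcal E\subseteq\mathbb E_\kappa$ is a large cellular coarse structure on $\omega\})$. Here $\mathfrak c=2^{\aleph_0}$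 and $\mathfrak c^+$ is its cardinal successor. $\mathfrak b$ and $\mathfrak d$ are the smallest cardinalities of an unbounded, respectively dominating, subset of $(\omega^\omega,\le^* )$ (eventual domination). With $a\subseteq^* b$ meaning $a\setminus b$ is finite and $[\omega]^\omega$ the family of infinite subsets of $\omega$, $\mathfrak t=\min\{|T|:T\subseteq[\omega]^\omega,\ (\forall s,t\in T\ s\subseteq^* t\text{ or }t\subseteq^* s),\ (\forall s\in[\omega]^\omega\,\exists t\in T\ s\not\subseteq^* t)\}$. *)

(* Defs.v *)
(* Cardinals are represented by sets, as in cardinality.v: equality of         *)
(* cardinals is equipotence [#=] and their order is [#<=].                     *)
From mathcomp Require Import all_boot.
From mathcomp Require Import boolp classical_sets functions cardinality filter.
From Stdlib Require Import RelationClasses.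

Set Implicit Arguments.
Unset Strict Implicit.
Unset Printing Implicit Defensive.

Local Open Scope classical_set_scope.
Local Open Scope card_scope.

(* A member of smallest cardinality of a family of sets (set0 if F is empty).  *)
Definition min_card {U : Type} (F : set (set U)) : set U :=
  xget set0 [set K | F K /\ forall L, F L -> K #<= L].

Lemma min_cardP {U : Type} (F : set (set U)) : F !=set0 ->
  F (min_card F) /\ forall L, F L -> min_card F #<= L.
Proof.
case=> F0 FF0; rewrite /min_card.
apply: (@xgetPex _ set0 [set K | F K /\ forall L, F L -> K #<= L]).
have [F00|/set0P[u0 _]] := eqVneq F0 set0.
  rewrite F00 in FF0.
  by exists set0; split=> // L _; exact: card_ge0.
(* S is a maximal set of choice functions with all projections injective.      *)
pose P (S : set (set U -> U)) :=
  (forall f A, S f -> F A -> A (f A)) /\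
  (forall f g A, S f -> S g -> F A -> f A = g A -> f = g).
have [C CP Ctot|S [[SF Sinj] Smax]] := @Zorn_bigcup (set U -> U) P.
  split=> [f A [X CX Xf] FA|f g A [X CX Xf] [Y CY Yg] FA fg].
    by case: (CP _ CX) => XF _; exact: XF Xf FA.
  have [XY|YX] := Ctot _ _ CX CY.
    by case: (CP _ CY) => _ /(_ f g A (XY _ Xf) Yg FA fg).
  by case: (CP _ CX) => _ /(_ f g A Xf (YX _ Yg) FA fg).
have [A [FA Asurj]] :
    exists A, F A /\ forall a, A a -> exists2 f, S f & f A = a.
  apply: contrapT => noA.
  have missed A : exists a, F A -> A a /\ forall f, S f -> f A <> a.
    have [FA|nFA] := pselect (F A); last by exists u0 => /nFA.
    apply: contrapT => na; apply: noA; exists A; split=> // a Aa.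
    apply: contrapT => nf; apply: na; exists a => _; split=> // f Sf fA.
    by apply: nf; exists f.
  have [h hP] := choice missed.
  apply: (Smax (S `|` [set h])).
    split=> [|Sub]; first by left.
    have Sh : S h by apply: Sub; right.
    by have [_ /(_ _ Sh)] := hP _ FF0.
  split=> [f B [Sf|->] FB|f g B [Sf|->] [Sg|->] FB fg //].
  - exact: SF Sf FB.
  - by have [] := hP _ FB.
  - exact: Sinj Sf Sg FB fg.
  - by have [_ /(_ _ Sf)] := hP _ FB.
  - by have [_ /(_ _ Sg)] := hP _ FB; rewrite fg.
exists A; split=> // B FB.
have lift a : exists f : set U -> U, A a -> S f /\ f A = a.
  have [Aa|nAa] := pselect (A a); last by exists (fun=> a).
  by have [f Sf fA] := Asurj _ Aa; exists f.
have [k kP] := choice lift.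
have kB : set_fun A B (fun a => k a B).
  by move=> a /kP[Sk _]; exact: SF Sk FB.
have kI : set_inj A (fun a => k a B).
  move=> a b /set_mem /kP[Sa ka] /set_mem /kP[Sb kb] kab.
  by rewrite -ka -kb (Sinj _ _ _ Sa Sb FB kab).
have [f] : $|{injfun A >-> B}|.
  by apply/injfunPex; exists (fun a => k a B).
exact: inj_card_le f.
Qed.

(* The cardinal successor, realized inside [set T]: its members that lie       *)
(* strictly above A include [set: set T] by Cantor's theorem.                  *)
Definition card_succ {T : Type} (A : set T) : set (set T) :=
  min_card [set K | A #<= K /\ ~ (K #<= A)].

Definition continuum : set (set nat) := [set: set nat].

Section Coarse.
Context {X : Type}.
Implicit Types (E F : set (X * X)) (EE : set (set (X * X))) (A B : set X).

Definition entourage_on E := diagonal `<=` E.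

(* E[A]; the ball E(x) is [xsection E x] *)
Definition thickening E A : set X := \bigcup_(a in A) xsection E a.

(* [B \; A] relates x to y when A x z and B z y for some z, so the product EF  *)
(* (first E, then F) is [F \; E].                                              *)
Definition coarse_structure EE :=
  [/\ EE `<=` entourage_on,
      \bigcup_(E in EE) E = [set: X * X],
      forall E F, EE E -> EE F ->
        exists2 T, EE T & (F^-1 \; E)%relation `<=` T
    & forall E F, EE E -> entourage_on F -> F `<=` E -> EE F].

Definition coarse_base EE (BB : set (set (X * X))) :=
  BB `<=` EE /\ forall E, EE E -> exists2 B, BB B & E `<=` B.

Definition weight EE : set (set (X * X)) :=
  min_card [set BB | coarse_base EE BB].

Definition cellular EE :=
  exists2 BB, coarse_base EE BB &
    forall E, BB E -> Equivalence (fun x y => E (x, y)).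

Definition coarse_bounded EE A :=
  exists E x, EE E /\ A `<=` xsection E x.

Definition coarse_unbounded EE A := ~ coarse_bounded EE A.

Definition coarse_discrete EE A :=
  forall E, EE E ->
    coarse_bounded EE [set x | A x /\ A `&` xsection E x <> [set x]].

Definition large_set EE A := exists2 E, EE E & thickening E A = [set: X].

Definition coarse_separated EE A B :=
  forall E, EE E -> coarse_bounded EE (thickening E A `&` thickening E B).

Definition indiscrete EE :=
  coarse_unbounded EE [set: X] /\
  forall A, coarse_discrete EE A -> coarse_bounded EE A.

Definition inseparated EE :=
  coarse_unbounded EE [set: X] /\
  ~ exists A B, [/\ coarse_unbounded EE A, coarse_unbounded EE B
                  & coarse_separated EE A B].

Definition large EE :=
  coarse_unbounded EE [set: X] /\
  forall A, coarse_unbounded EE A -> large_set EE A.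

End Coarse.

Definition E_omega : set (set (nat * nat)) :=
  [set E | entourage_on E /\ exists n, forall x,
     xsection E x #<= `I_n /\ xsection (E^-1)%relation x #<= `I_n].

Definition E_omega1 : set (set (nat * nat)) :=
  [set E | entourage_on E /\ forall x,
     finite_set (xsection E x) /\ finite_set (xsection (E^-1)%relation x)].

(* The least element of {c^+} together with the weights of the cellular coarse *)
(* structures contained in EE and satisfying P.                                *)
Definition min_weight (P : set (set (nat * nat)) -> Prop)
    (EE : set (set (nat * nat))) : set (set (set nat)) :=
  min_card [set K | K #= card_succ continuum \/
    exists CC, [/\ CC `<=` EE, coarse_structure CC, P CC, cellular CC
                 & K #= weight CC]].

Definition Delta_cell := min_weight indiscrete.
Definition Sigma_cell := min_weight inseparated.
Definition Lambda_cell := min_weight large.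

Definition le_star (f g : nat -> nat) := \forall n \near \oo, (f n <= g n)%N.

Definition b_card : set (nat -> nat) :=
  min_card [set B | ~ exists g, forall f, B f -> le_star f g].

Definition d_card : set (nat -> nat) :=
  min_card [set D | forall f, exists2 g, D g & le_star f g].

Definition subset_star (a b : set nat) := finite_set (a `\` b).

Definition t_card : set (set nat) :=
  min_card [set T | [/\ forall t, T t -> infinite_set t,
    total_on T subset_star
    & forall s, infinite_set s -> exists2 t, T t & ~ subset_star s t]].

(* Main.v *)
Require Import Defs.
From mathcomp Require Import all_boot.
From mathcomp Require Import boolp classical_sets functions cardinality filter.
From mathcomp Require Import wochoice.
From Stdlib Require Import RelationClasses Wellfounded.
From Stdlib Require List.

(** The structures contained in [E_omega1] have exactly the finite sets as their
    bounded sets, and a cellular one is generated by any directed covering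
    family of equivalence relations with finite cells ([coarse_gen]).  All
    existence claims construct such families, and [weight_le] bounds the weight
    by their size.

    No structure in [E_omega] is large ([no_large_omega]): large structures have
    relations with all cells as big as desired, and a set A that meets almost
    all cells of these relations in at most one point has density zero, whereas
    a set that meets all cells of a relation with cells of size at most n has
    density at least 1/n.  The density is never defined, because one counts
    inside a single cell of a common coarsening.

    An infinite discrete set D can be cut into pairs, and the relation
    identifying the two points of each pair can be joined to a structure in
    [E_omega] without leaving [E_omega], since apart from a finite set every
    cell contains at most one point of D, so that cells are merged two by two
    ([glue_pairs]).  A maximal family of relations with all finite joins in
    [E_omega] therefore generates an indiscrete structure ([indiscrete_omega]),
    which gives Delta <= c.  If Delta = c, a structure with fewer than c
    generators has an infinite discrete set inside every infinite set A
    ([small_base_discrete]), for otherwise its restriction to A would be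
    indiscrete.  A recursion of length c over all pairs (A, B) then joins, at
    each step, pairs with one point in A and the other in B
    ([joinable_unseparate]), and its result is inseparated
    ([inseparated_omega]).
    The converse Delta <= Sigma holds because the two halves of an infinite
    discrete set are separated ([inseparated_indiscrete]).

    In [E_omega1], the balls of a relation E are bounded by a function.  If one
    g dominates these functions for all E in a base, a sequence that outgrows g
    is discrete, so indiscrete structures have weight at least b
    ([b_le_weight]); if every infinite set is large, iterates of these functions
    dominate all enumerations of infinite sets, so large structures have weight
    at least d ([d_le_weight]).  These bounds are attained by structures of
    intervals: a set P of points of the line cuts it into intervals, almost
    inclusion of such sets P corresponds to refinement of the partitions, and
    hence a tower of sets generates a cellular structure.  When t = b or t = d,
    a recursion along an unbounded or dominating family F yields a tower that
    contains, for each f in F, a set whose gaps exceed f ([sparse_tower]):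
    fewer than t sets of a tower have a pseudo-intersection.  Unboundedness of
    F then gives inseparatedness ([b_structure]) and domination gives largeness
    ([d_structure]). *)

Set Implicit Arguments.
Unset Strict Implicit.
Unset Printing Implicit Defensive.

Local Open Scope classical_set_scope.
Local Open Scope card_scope.

(** * Cardinal arithmetic *)

Lemma inj_on_card_le {T U : Type} {A : set T} {B : set U} (f : T -> U) :
  (forall x, A x -> B (f x)) ->
  (forall x y, A x -> A y -> f x = f y -> x = y) -> A #<= B.
Proof.
move=> fAB finj; have [g] : $|{injfun A >-> B}|.
  apply/injfunPex; exists f; first exact: fAB.
  by move=> x y /set_mem Ax /set_mem Ay; exact: finj.
exact: inj_card_le g.
Qed.

Lemma card_le_inj_on {T U : Type} {A : set T} {B : set U} (u : U) : A #<= B ->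
  exists f : T -> U, (forall x, A x -> B (f x)) /\
    (forall x y, A x -> A y -> f x = f y -> x = y).
Proof.
move=> /card_leP/injfunPex[f _ finj].
exists (fun x => if pselect (A x) is left Ax then val (f (SigSub (mem_set Ax)))
                 else u).
split=> [x Ax|x y Ax Ay].
  by case: pselect => // Ax'; exact: set_valP.
case: pselect => // Ax'; case: pselect => // Ay' fxy.
by have /(congr1 val) := finj _ _ (in_setT _) (in_setT _) (val_inj fxy).
Qed.

Lemma infinite_injection {T : Type} {A : set T} : infinite_set A ->
  exists e : nat -> T, injective e /\ forall n, A (e n).
Proof.
move=> Ainf; have [t0 _] := infinite_setN0 Ainf.
have [e [eA einj]] := card_le_inj_on t0 ((infiniteP A).1 Ainf).
by exists e; split=> [m n|n]; [exact: einj|exact: eA].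
Qed.

Lemma injection_infinite {T : Type} {A : set T} (e : nat -> T) :
  injective e -> (forall n, A (e n)) -> infinite_set A.
Proof.
move=> einj eA; apply/infiniteP.
by apply: (inj_on_card_le (f := e)) => [n _|m n _ _ /einj]; [exact: eA|].
Qed.

Lemma range_infinite {T : Type} (e : nat -> T) :
  injective e -> infinite_set (range e).
Proof. by move=> einj; apply: (injection_infinite einj) => n; exists n. Qed.

Lemma finite_set_sub_II (A : set nat) : finite_set A -> exists N, A `<=` `I_N.
Proof.
move=> /finite_seqP[s ->]; exists (\max_(i <- s) i).+1 => x /= xs.
by rewrite ltnS; exact: leq_bigmax_seq.
Qed.

(** Both sets embed in the sum of the two types, where the smaller one can be
    selected as a cardinal minimum. *)
Lemma card_le_total {T U : Type} (A : set T) (B : set U) :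
  A #<= B \/ B #<= A.
Proof.
pose F := [set K | K = inl @` A \/ K = (@inr T U) @` B].
have iA : @inl T U @` A #= A by apply: inj_card_eq => x y _ _ [].
have iB : @inr T U @` B #= B by apply: inj_card_eq => x y _ _ [].
have [|FF min] := @min_cardP _ F; first by exists (inl @` A); left.
have mA := min _ (or_introl erefl); have mB := min _ (or_intror erefl).
case: FF mA mB => -> mA mB.
  by left; rewrite -(card_le_eql iA) -(card_le_eqr iB).
by right; rewrite -(card_le_eql iB) -(card_le_eqr iA).
Qed.

(** Zorn's lemma is applied to the members of P above G0 together with the empty
    set, which serves as the union of the empty chain. *)
Lemma Zorn_bigcup_above {T : Type} (P : set (set T)) (G0 : set T) :
  P G0 ->
  (forall F, F `<=` P -> F !=set0 -> total_on F subset ->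
    P (\bigcup_(X in F) X)) ->
  exists A, [/\ G0 `<=` A, P A & forall B, A `<=` B -> P B -> B = A].
Proof.
move=> PG0 Pcup; pose P' G := G = set0 \/ (P G /\ G0 `<=` G).
have [F FP' Ftot|A [P'A Amax]] := @Zorn_bigcup _ P'.
  pose F' := [set X | F X /\ (P X /\ G0 `<=` X)].
  have -> : \bigcup_(X in F) X = \bigcup_(X in F') X.
    apply/seteqP; split=> [x [X FX Xx]|x [X [FX _] Xx]]; last by exists X.
    by exists X => //; have [X0|] := FP' _ FX; first by rewrite X0 in Xx.
  have [F0|/set0P F0] := eqVneq F' set0; first by left; rewrite F0 bigcup_set0.
  right; split.
    apply: Pcup => // [X [_ []] //|X Y [FX _] [FY _]]; exact: Ftot.
  by have [X [FX [PX GX]]] := F0; move=> x /GX Xx; exists X.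
have maxA B : A `<=` B -> P B -> G0 `<=` B -> B = A.
  move=> AB PB GB; apply: contrapT => BA; apply: (Amax B); last by right.
  split=> // BA'; apply: BA; exact/seteqP.
have [A0|[PA GA]] := P'A; last first.
  by exists A; split=> // B AB PB; apply: maxA => //; exact: subset_trans GA AB.
have G00 : G0 = A by apply: maxA; rewrite ?A0.
by exists A; rewrite -{1 2}G00; split=> // B AB PB; apply: maxA; rewrite ?G00.
Qed.

(** Zorn's lemma, applied to injections D * D -> D coded by their graphs, gives
    a maximal such D.  If the complement of D is larger than D, it has room for
    a copy D' of D, and the injection extends to D + D' because the new part
    of the square consists of three copies of D * D.  So the complement of D is
    at most D, whence the whole type has the cardinality of D. *)
Lemma infinite_pairing {T : Type} : infinite_set [set: T] ->
  exists q : T -> T -> T, forall x y x' y', q x y = q x' y' -> x = x' /\ y = y'.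
Proof.
move=> Tinf; have [t0 _] := infinite_setN0 Tinf.
have [e [einj _]] := infinite_injection Tinf.
pose dom (G : set ((T * T) * T)) := [set x | exists z, G ((x, x), z)].
pose good (G : set ((T * T) * T)) := [/\
  forall p z z', G (p, z) -> G (p, z') -> z = z',
  forall p p' z, G (p, z) -> G (p', z) -> p = p',
  forall x y z, G ((x, y), z) -> [/\ dom G x, dom G y & dom G z]
  & forall x y, dom G x -> dom G y -> exists z, G ((x, y), z)].
pose G0 := [set (((e mn.1, e mn.2), e (pickle mn)) : (T * T) * T)
           | mn in [set: nat * nat]].
have domG0 n : dom G0 (e n) by exists (e (pickle (n, n))); exists (n, n).
have [||G [GG0 [Gfun Ginj Gran Gtot] Gmax]] := @Zorn_bigcup_above _ good G0.
- split.
  + move=> p z z' [[m n] _ [<- <-]] [[m' n'] _ [/einj + /einj + <-]] /=.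
    by move=> -> ->.
  + move=> p p' z [[m n] _ [<- <-]] [[m' n'] _ [<- /einj]].
    by move/(pcan_inj pickleK) => [-> ->].
  + move=> x y z [[m n] _ [<- <- <-]]; split; exact: domG0.
  + move=> x y [z [[m n] _ [<- _ _]]] [z' [[m' n'] _ [<- _ _]]].
    by exists (e (pickle (m, m'))); exists (m, m').
- move=> F Fgood [X0 FX0] Ftot.
  have two X Y : F X -> F Y -> exists2 Z, F Z & X `<=` Z /\ Y `<=` Z.
    move=> FX FY; have [XY|YX] := Ftot _ _ FX FY.
      by exists Y => //; split.
    by exists X => //; split.
  have domF X x : F X -> dom X x -> dom (\bigcup_(X in F) X) x.
    by move=> FX [z Xz]; exists z; exists X.
  split.
  + move=> p z z' [X FX Xz] [Y FY Yz']; have [Z FZ [XZ YZ]] := two _ _ FX FY.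
    by have [h _ _ _] := Fgood _ FZ; exact: h (XZ _ Xz) (YZ _ Yz').
  + move=> p p' z [X FX Xz] [Y FY Yz']; have [Z FZ [XZ YZ]] := two _ _ FX FY.
    by have [_ h _ _] := Fgood _ FZ; exact: h (XZ _ Xz) (YZ _ Yz').
  + move=> x y z [X FX Xz]; have [_ _ /(_ _ _ _ Xz)[? ? ?] _] := Fgood _ FX.
    by split; exact: domF FX _.
  + move=> x y [z [X FX Xz]] [z' [Y FY Yz']].
    have [Z FZ [XZ YZ]] := two _ _ FX FY.
    have [_ _ _ /(_ x y)] := Fgood _ FZ.
    move=> [||w Zw]; [by exists z; exact: XZ|by exists z'; exact: YZ|].
    by exists w; exists Z.
pose Y := dom G.
have Ye n : Y (e n) by have [z /GG0] := domG0 n; exists z.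
have /choice[q qG] (p : T * T) : exists z, Y p.1 -> Y p.2 -> G (p, z).
  case: p => x y /=; have [[Yx Yy]|n] := pselect (Y x /\ Y y); last first.
    by exists t0 => ? ?; case: n.
  by have [z Gz] := Gtot _ _ Yx Yy; exists z.
have qY x y : Y x -> Y y -> Y (q (x, y)).
  by move=> Yx Yy; have [] := Gran _ _ _ (qG (x, y) Yx Yy).
have qinj x y x' y' : Y x -> Y y -> Y x' -> Y y' -> q (x, y) = q (x', y') ->
    x = x' /\ y = y'.
  move=> Yx Yy Yx' Yy' qq; have := qG (x', y') Yx' Yy'; rewrite -qq.
  by move=> /(Ginj _ _ _ (qG (x, y) Yx Yy)) [-> ->].
have e01 : e 0 <> e 1 by move/einj.
have [CY|YC] := card_le_total (~` Y) Y.
  have [g [gY ginj]] := card_le_inj_on t0 CY.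
  pose h x := if pselect (Y x) then q (e 0, x) else q (e 1, g x).
  have hY x : Y (h x).
    by rewrite /h; case: pselect => Yx; apply: qY => //; exact: gY.
  have hinj x y : h x = h y -> x = y.
    rewrite /h; case: pselect => Yx; case: pselect => Yy E.
    - by have [] := qinj _ _ _ _ (Ye 0) Yx (Ye 0) Yy E.
    - by have [/e01] := qinj _ _ _ _ (Ye 0) Yx (Ye 1) (gY _ Yy) E.
    - by have [/esym/e01] := qinj _ _ _ _ (Ye 1) (gY _ Yx) (Ye 0) Yy E.
    - have [_] := qinj _ _ _ _ (Ye 1) (gY _ Yx) (Ye 1) (gY _ Yy) E.
      exact: ginj.
  by exists (fun x y => q (h x, h y)) => x y x' y' /qinj[] // /hinj-> /hinj->.
exfalso; have [g [gY ginj]] := card_le_inj_on t0 YC.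
pose phi (i : bool) u := if i then g u else u.
have phiinj i u j v : Y u -> Y v -> phi i u = phi j v -> i = j /\ u = v.
  move=> Yu Yv; case: i; case: j => //= E.
  - by split=> //; exact: ginj.
  - by exfalso; apply: (gY _ Yu); rewrite E.
  - by exfalso; apply: (gY _ Yv); rewrite -E.
pose new (ij : bool * bool) u v := g (q (e (pickle ij), q (u, v))).
pose H := [set r | exists i j u v, [/\ i || j, Y u, Y v
  & r = ((phi i u, phi j v), new (i, j) u v)]].
have newZ ij u v : Y u -> Y v -> exists2 w, Y w & new ij u v = phi true w.
  move=> Yu Yv; exists (q (e (pickle ij), q (u, v))) => //.
  by do 2!apply: (qY) => //.
have newinj ij kl u v u' v' : Y u -> Y v -> Y u' -> Y v' ->
    new ij u v = new kl u' v' -> [/\ ij = kl, u = u' & v = v'].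
  move=> Yu Yv Yu' Yv' E; have Y1 := qY _ _ Yu Yv; have Y2 := qY _ _ Yu' Yv'.
  have E1 := ginj _ _ (qY _ _ (Ye _) Y1) (qY _ _ (Ye _) Y2) E.
  have [/einj/(pcan_inj pickleK) -> E2] := qinj _ _ _ _ (Ye _) Y1 (Ye _) Y2 E1.
  by have [-> ->] := qinj _ _ _ _ Yu Yv Yu' Yv' E2.
have domH x : dom (G `|` H) x <-> exists i u, Y u /\ x = phi i u.
  split=> [[z [Gz|[i [j [u [v [_ Yu Yv [-> _ _]]]]]]]]|[[] [u [Yu ->]]]].
  - by exists false, x; split=> //; exists z.
  - by exists i, u.
  - by exists (new (true, true) u u); right; exists true, true, u, u.
  - by exists (q (u, u)); left; exact: (qG (u, u)).
have GH : G `|` H = G.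
  apply: Gmax; first by move=> ? ?; left.
  have Gphi x y z : G ((x, y), z) -> [/\ Y x, Y y & Y z] by exact: Gran.
  have disj i j u v x y : i || j -> Y u -> Y v -> Y x -> Y y ->
      (phi i u, phi j v) <> (x, y).
    move=> ij Yu Yv Yx Yy [/(phiinj _ _ false) -/(_ Yu Yx)[i0 _]].
    by move=> /(phiinj _ _ false) -/(_ Yv Yy)[j0 _]; rewrite i0 j0 in ij.
  split.
  + move=> [x y] z z' [Gz|[i [j [u [v [ij Yu Yv [xE yE zE]]]]]]]
      [Gz'|[k [l [u' [v' [kl Yu' Yv' [xE' yE' zE']]]]]]].
    * exact: Gfun Gz Gz'.
    * have [Yx Yy _] := Gphi _ _ _ Gz.
      by case: (disj k l u' v' x y) => //; rewrite xE' yE'.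
    * have [Yx Yy _] := Gphi _ _ _ Gz'.
      by case: (disj i j u v x y) => //; rewrite xE yE.
    * move: xE' yE'; rewrite xE yE => /phiinj[]// ik uu /phiinj[]// jl vv.
      by rewrite zE zE' ik jl uu vv.
  + move=> [x y] [x' y'] z [Gz|[i [j [u [v [ij Yu Yv [xE yE zE]]]]]]]
      [Gz'|[k [l [u' [v' [kl Yu' Yv' [xE' yE' zE']]]]]]].
    * exact: Ginj Gz Gz'.
    * have [_ _ Yz] := Gphi _ _ _ Gz; have [w Yw wE] := newZ (k, l) _ _ Yu' Yv'.
      by exfalso; move: Yz; rewrite zE' wE; exact: (gY _ Yw).
    * have [_ _ Yz] := Gphi _ _ _ Gz'; have [w Yw wE] := newZ (i, j) _ _ Yu Yv.
      by exfalso; move: Yz; rewrite zE wE; exact: (gY _ Yw).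
    * move: zE'; rewrite zE => /newinj[]// [ik jl] uu vv.
      by rewrite xE yE xE' yE' ik jl uu vv.
  + move=> x y z [Gz|[i [j [u [v [ij Yu Yv [-> -> ->]]]]]]].
      have [Yx Yy Yz] := Gphi _ _ _ Gz.
      by split; apply/domH; [exists false, x|exists false, y|exists false, z].
    have [w Yw ->] := newZ (i, j) _ _ Yu Yv.
    by split; apply/domH; [exists i, u|exists j, v|exists true, w].
  + move=> x y /domH[i [u [Yu ->]]] /domH[j [v [Yv ->]]].
    have [ij|] := boolP (i || j).
      by exists (new (i, j) u v); right; exists i, j, u, v.
    by case: i; case: j => //= _; exists (q (u, v)); left; exact: (qG (u, v)).
apply: (gY (e 0) (Ye 0)); rewrite -/Y /Y -GH.
by apply/domH; exists true, (e 0).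
Qed.

Lemma infinite_pairing_in {T : Type} (A : set T) : infinite_set A ->
  exists q : T -> T -> T, (forall x y, A x -> A y -> A (q x y)) /\
    forall x y x' y', A x -> A y -> A x' -> A y' ->
      q x y = q x' y' -> x = x' /\ y = y'.
Proof.
move=> Ainf; have : infinite_set [set: A].
  by rewrite (eq_finite_set (card_setT A)).
move=> /infinite_pairing[q qinj].
exists (fun x y => if pselect (A x) is left Ax then
                     if pselect (A y) is left Ay then
                       val (q (SigSub (mem_set Ax)) (SigSub (mem_set Ay)))
                     else x
                   else x).
split=> [x y Ax Ay|x y x' y' Ax Ay Ax' Ay'].
  by do 2!case: pselect => // ?; exact: set_valP.
do 4!case: pselect => // ?.
by move=> /val_inj/qinj[/(congr1 val)/= -> /(congr1 val)/= ->].
Qed.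

Section infinite_cardinals.
Context {T U V : Type} {A : set T} {B : set U} {C : set V}.
Context (Ainf : infinite_set A) (BA : B #<= A).

Lemma card_le_setX : C #<= A -> B `*` C #<= A.
Proof.
move=> CA; have [t0 _] := infinite_setN0 Ainf.
have [q [qA qinj]] := infinite_pairing_in Ainf.
have [f [fA finj]] := card_le_inj_on t0 BA.
have [g [gA ginj]] := card_le_inj_on t0 CA.
apply: (@inj_on_card_le _ _ _ _ (fun p => q (f p.1) (g p.2))) => [p [Bp Cp]|].
  by apply: qA; [exact: fA|exact: gA].
move=> [x y] [x' y'] [/= Bx Cy] [/= Bx' Cy'].
move=> /(qinj _ _ _ _ (fA _ Bx) (gA _ Cy) (fA _ Bx') (gA _ Cy'))[].
by move=> /(finj _ _ Bx Bx') -> /(ginj _ _ Cy Cy') ->.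
Qed.

Lemma card_le_seq : [set l : seq U | List.Forall B l] #<= A.
Proof.
have [t0 At0] := infinite_setN0 Ainf.
have [q [qA qinj]] := infinite_pairing_in Ainf.
have [f [fA finj]] := card_le_inj_on t0 BA.
have [e [einj eA]] := infinite_injection Ainf.
pose enc := foldr (fun x => q (f x)) t0.
have encA l : List.Forall B l -> A (enc l).
  by elim=> [//|x {}l Bx _ IH]; apply: qA => //; exact: fA.
apply: (@inj_on_card_le _ _ _ _ (fun l => q (e (size l)) (enc l))).
  by move=> l Bl; apply: qA => //; exact: encA.
move=> l l' Bl Bl' /(qinj _ _ _ _ (eA _) (encA _ Bl) (eA _) (encA _ Bl'))[].
move=> /einj; elim: Bl l' Bl' => [|x {}l Bx Bl IH] [|x' l'] // Bl'.
inversion_clear Bl' as [|? ? Bx' Bl'']; case=> sz.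
move=> /(qinj _ _ _ _ (fA _ Bx) (encA _ Bl) (fA _ Bx') (encA _ Bl''))[].
by move=> /(finj _ _ Bx Bx') -> /(IH _ Bl'' sz) ->.
Qed.

End infinite_cardinals.

Lemma card_le_setU {T U : Type} {A : set T} {B C : set U} :
  infinite_set A -> B #<= A -> C #<= A -> B `|` C #<= A.
Proof.
move=> Ainf BA CA; have [t0 _] := infinite_setN0 Ainf.
have [q [qA qinj]] := infinite_pairing_in Ainf.
have [f [fA finj]] := card_le_inj_on t0 BA.
have [g [gA ginj]] := card_le_inj_on t0 CA.
have [e [einj eA]] := infinite_injection Ainf.
pose h x := if pselect (B x) then q (e 0) (f x) else q (e 1) (g x).
apply: (inj_on_card_le (f := h)) => [x BCx|x y BCx BCy]; rewrite /h.
  by case: pselect => Bx; apply: qA => //; [exact: fA|apply: gA; case: BCx].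
case: pselect => Bx; case: pselect => By.
- by move=> /(qinj _ _ _ _ (eA 0) (fA _ Bx) (eA 0) (fA _ By))[_ /finj]; exact.
- have Cy : C y by case: BCy.
  by move=> /(qinj _ _ _ _ (eA 0) (fA _ Bx) (eA 1) (gA _ Cy))[/einj].
- have Cx : C x by case: BCx.
  by move=> /(qinj _ _ _ _ (eA 1) (gA _ Cx) (eA 0) (fA _ By))[/einj].
- have Cx : C x by case: BCx.
  have Cy : C y by case: BCy.
  by move=> /(qinj _ _ _ _ (eA 1) (gA _ Cx) (eA 1) (gA _ Cy))[_ /ginj]; exact.
Qed.

(** * Well-orders and transfinite recursion *)

Definition strict_well_order {T : Type} (R : T -> T -> Prop) :=
  [/\ well_founded R, forall x y z, R x y -> R y z -> R x z
    & forall x y, [\/ R x y, x = y | R y x]].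

Lemma well_founded_least {T : Type} (R : T -> T -> Prop) (P : T -> Prop) :
  well_founded R -> (exists x, P x) ->
  exists x, P x /\ forall y, R y x -> ~ P y.
Proof.
move=> Rwf [x0 Px0]; apply: contrapT => nex.
elim/(well_founded_ind Rwf): x0 Px0 => x IH Px.
by apply: nex; exists x; split.
Qed.

Lemma exists_strict_well_order (T : Type) :
  exists R : T -> T -> Prop, strict_well_order R.
Proof.
elim/Peq : T => T; have [R Rwo] := @well_ordering_principle T.
have Rmin (A : {pred T}) x : x \in A ->
    exists2 z, z \in A & forall y, y \in A -> R z y.
  by move=> Ax; have [|z [[Az zmin] _]] := Rwo A; [exists x|exists z].
have Rch : wo_chain R predT by move=> A _; exact: Rwo.
have Rtot x y : R x y || R y x by exact: (wo_chainW Rch).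
have Ranti x y : R x y -> R y x -> x = y.
  by move=> xy yx; apply: (wo_chain_antisymmetric Rch) => //; rewrite xy yx.
exists (fun x y => R x y /\ x <> y); split.
- move=> x; apply: contrapT => nx.
  have [|z /asboolP nz zmin] := Rmin [pred x |
    `[< ~ Acc (fun x y => R x y /\ x <> y) x >]] x; first exact/asboolP.
  apply: nz; apply: Acc_intro => y [Ryz yz]; apply: contrapT => ny.
  by apply: yz; apply: Ranti => //; apply: zmin; apply/asboolP.
- move=> x y z [xy nxy] [yz nyz].
  have Rxz : R x z.
    have [|w + wmin] := Rmin (mem [:: x; y; z]) x; first by rewrite inE eqxx.
    rewrite !inE => /or3P[] /eqP wE; rewrite {}wE in wmin.
    + by apply: wmin; rewrite !inE eqxx !orbT.
    + have yx : R y x by apply: wmin; rewrite !inE eqxx.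
      by case: nxy; exact: Ranti.
    + have zy : R z y by apply: wmin; rewrite !inE eqxx orbT.
      by case: nyz; exact: Ranti.
  by split=> // xz; apply: nyz; apply: Ranti => //; rewrite -xz.
- move=> x y; have [->|/eqP xy] := eqVneq x y; first by constructor 2.
  have /orP[|] := Rtot x y; first by constructor 1.
  by constructor 3; split=> // yx; exact: xy.
Qed.

(** If some initial segment has the cardinality of T, the least such segment
    receives an injection of T, along which its order is pulled back. *)
Lemma exists_initial_well_order (T : Type) :
  exists R : T -> T -> Prop, strict_well_order R /\
    forall x, ~ ([set: T] #<= [set y | R y x]).
Proof.
have [R [Rwf Rtr Rtri]] := exists_strict_well_order T.
have [small|] := pselect (forall x, ~ ([set: T] #<= [set y | R y x])).
  by exists R.
move=> /existsNP[x0 /contrapT x0P].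
pose big x := [set: T] #<= [set y | R y x].
have [x [xP xmin]] := @well_founded_least _ R big Rwf (ex_intro _ x0 x0P).
have [f [fx finj']] := card_le_inj_on x xP.
have finj a b : f a = f b -> a = b by exact: finj'.
exists (fun a b => R (f a) (f b)); split; first split.
- exact: wf_inverse_image.
- by move=> a b c; exact: Rtr.
- move=> a b; have [ab|/finj ab|ba] := Rtri (f a) (f b);
    by [constructor 1|constructor 2|constructor 3].
move=> a /card_le_trans aP; apply: (xmin (f a) (fx a I)); apply: aP.
by apply: (@inj_on_card_le _ _ _ _ f) => // b c _ _; exact: finj.
Qed.

(** Here Q i f v says that v is admissible as value at i when f gives the values
    below i. *)
Lemma transfinite_choice {I V : Type} (R : I -> I -> Prop)
    (Q : I -> (I -> V) -> V -> Prop) (v0 : V) :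
  strict_well_order R ->
  (forall i f g v, (forall j, R j i -> f j = g j) -> Q i f v -> Q i g v) ->
  (forall i f, (forall j, R j i -> Q j f (f j)) -> exists v, Q i f v) ->
  exists f, forall i, Q i f (f i).
Proof.
move=> [Rwf Rtr Rtri] Qloc Qex.
have /choice[s sP] (p : I * (I -> V)) : exists v,
    (forall j, R j p.1 -> Q j p.2 (p.2 j)) -> Q p.1 p.2 v.
  case: p => i f /=; have [H|H] := pselect (forall j, R j i -> Q j f (f j)).
    by have [v Qv] := Qex _ _ H; exists v.
  by exists v0.
pose cut i (g : forall j, R j i -> V) j :=
  if pselect (R j i) is left ji then g j ji else v0.
pose F i (g : forall j, R j i -> V) := s (i, cut i g).
pose f := Fix Rwf (fun=> V) F.
have fE i : f i = s (i, cut i (fun j _ => f j)).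
  rewrite /f Fix_eq// => x g g' gg'; congr (s (_, _)); apply/funext => j.
  by rewrite /cut; case: pselect.
have cutE i j : R j i -> cut i (fun j _ => f j) j = f j.
  by rewrite /cut; case: pselect.
exists f; elim/(well_founded_ind Rwf) => i IH.
rewrite fE; apply: (Qloc i (cut i (fun j _ => f j))) => [j ji|].
  exact: cutE.
apply: (sP (i, _)) => /= j ji; rewrite cutE//.
apply: Qloc (IH _ ji) => k kj; rewrite cutE//; exact: Rtr kj ji.
Qed.

(** * Weights and the continuum *)

Lemma Cantor_card {T : Type} (t0 : T) : ~ ([set: set T] #<= [set: T]).
Proof.
move=> /(card_le_inj_on t0)[f [_ finj]].
pose D := [set n | exists2 X, f X = n & ~ X n].
have [[X fX nX]|nD] := pselect (D (f D)); last first.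
  by apply: (nD); exists D.
by move: (nX); rewrite (finj _ _ I I fX); apply; exists X.
Qed.

Lemma continuum_le_succ : continuum #<= card_succ continuum.
Proof.
have [|[]//] := @min_cardP _ [set K : set (set (set nat)) |
  continuum #<= K /\ ~ (K #<= continuum)].
exists [set: set (set nat)]; split.
  by apply: (inj_on_card_le (f := set1)) => // x y _ _ /seteqP[/(_ x erefl)].
exact: (Cantor_card set0).
Qed.

Lemma image_pickle_inj {T : countType} (A B : set T) :
  pickle @` A = pickle @` B -> A = B.
Proof.
have sub (C D : set T) : pickle @` C = pickle @` D -> C `<=` D.
  move=> CD p Cp; have : (pickle @` D) (pickle p) by rewrite -CD; exists p.
  by move=> [q Dq] /(pcan_inj pickleK) <-.
by move=> AB; apply/seteqP; split; exact: sub.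
Qed.

Lemma card_set_prod_nat : [set: set (nat * nat)] #<= continuum.
Proof.
apply: (inj_on_card_le (f := fun E => pickle @` E)) => // E F _ _.
exact: image_pickle_inj.
Qed.

Lemma card_sequences : [set: nat -> nat] #<= continuum.
Proof.
apply: card_le_trans card_set_prod_nat.
apply: (inj_on_card_le (f := fun f => [set p : nat * nat | p.2 = f p.1])) => //.
move=> f g _ _ /seteqP[fg _]; apply/funext => n; exact: (fg (n, f n)).
Qed.

Section weights.
Context {X : Type}.
Implicit Types EE BB : set (set (X * X)).

Lemma weight_base EE : coarse_base EE (weight EE).
Proof.
have [|//] := @min_cardP _ [set BB | coarse_base EE BB].
by exists EE; split=> // E EE_E; exists E.
Qed.

Lemma weight_le EE BB : coarse_base EE BB -> weight EE #<= BB.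
Proof.
move=> BBbase; have [|_] := @min_cardP _ [set BB | coarse_base EE BB].
  by exists BB.
exact.
Qed.

End weights.

Section min_weight.
Context (P : set (set (nat * nat)) -> Prop) (EE : set (set (nat * nat))).

Let F : set (set (set (set nat))) := [set K | K #= card_succ continuum \/
  exists CC, [/\ CC `<=` EE, coarse_structure CC, P CC, cellular CC
               & K #= weight CC]].

Let FP : F (min_weight P EE) /\ forall L, F L -> min_weight P EE #<= L.
Proof.
apply: min_cardP; exists (card_succ continuum); left; exact: card_eqxx.
Qed.

Lemma min_weight_cases : min_weight P EE #= card_succ continuum \/
  exists CC, [/\ CC `<=` EE, coarse_structure CC, P CC, cellular CC
               & min_weight P EE #= weight CC].
Proof. by have [] := FP. Qed.

Lemma min_weight_le_succ : min_weight P EE #<= card_succ continuum.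
Proof. by have [_] := FP; apply; left; exact: card_eqxx. Qed.

Lemma min_weight_le CC : CC `<=` EE -> coarse_structure CC -> P CC ->
  cellular CC -> min_weight P EE #<= weight CC.
Proof.
move=> CCE CCs PCC CCc.
(* Members of F are sets of sets of sets of numbers, so E is represented by the
   singleton of the set of codes of its points. *)
pose K := (fun E => [set pickle @` E]) @` weight CC.
have KE : K #= weight CC.
  apply: inj_card_eq => E F' _ _ /seteqP[/(_ _ erefl) /= EF _].
  exact: image_pickle_inj.
rewrite -(card_le_eqr KE); have [_] := FP; apply; right.
by exists CC.
Qed.

Lemma le_min_weight {T : Type} (K : set T) :
  K #<= continuum ->
  (forall CC, CC `<=` EE -> coarse_structure CC -> P CC -> cellular CC ->
    K #<= weight CC) -> K #<= min_weight P EE.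
Proof.
move=> Kc KCC; have [E|[CC [? ? ? ? E]]] := min_weight_cases.
  by rewrite (card_le_eqr E); exact: card_le_trans Kc continuum_le_succ.
by rewrite (card_le_eqr E); exact: KCC.
Qed.

End min_weight.

Lemma min_weight_mono (P Q : set (set (nat * nat)) -> Prop)
    (EE FF : set (set (nat * nat))) : EE `<=` FF ->
  (forall CC, CC `<=` EE -> coarse_structure CC -> cellular CC ->
    P CC -> Q CC) ->
  min_weight Q FF #<= min_weight P EE.
Proof.
move=> EF PQ; have [E|[CC [CE CCs PCC CCc E]]] := min_weight_cases P EE.
  by rewrite (card_le_eqr E); exact: min_weight_le_succ.
rewrite (card_le_eqr E); apply: min_weight_le => //; last exact: PQ.
exact: subset_trans CE EF.
Qed.

(** * Cellular coarse structures *)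

Definition equivalence_set {X : Type} (E : set (X * X)) :=
  Equivalence (fun x y => E (x, y)).

Section equivalences.
Context {X : Type} {E : set (X * X)} (Eeq : equivalence_set E).

Lemma equivalence_set_refl x : E (x, x).
Proof. by have [h _ _] := Eeq; exact: h. Qed.

Lemma equivalence_set_sym x y : E (x, y) -> E (y, x).
Proof. by have [_ h _] := Eeq; exact: h. Qed.

Lemma equivalence_set_trans x y z : E (x, y) -> E (y, z) -> E (x, z).
Proof. by have [_ _ h] := Eeq; exact: h. Qed.

Lemma equivalence_entourage : entourage_on E.
Proof. by move=> [x y] /diagonalP ->; exact: equivalence_set_refl. Qed.

Lemma equivalence_set_inv : (E^-1)%relation = E.
Proof.
by apply/seteqP; split=> -[x y] /= Exy; exact: equivalence_set_sym.
Qed.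

End equivalences.

Lemma xsection_sub {X : Type} (E F : set (X * X)) (x : X) :
  E `<=` F -> xsection E x `<=` xsection F x.
Proof. by move=> EF y /xsectionP Exy; apply/xsectionP; exact: EF. Qed.

Lemma thickening_sub {X : Type} (E F : set (X * X)) (A : set X) :
  E `<=` F -> thickening E A `<=` thickening F A.
Proof. by move=> EF x [a Aa ax]; exists a => //; exact: xsection_sub ax. Qed.

Lemma thickeningP {X : Type} (E : set (X * X)) (A : set X) x :
  thickening E A x <-> exists2 a, A a & E (a, x).
Proof. by split=> [[a Aa /xsectionP]|[a Aa /xsectionP]]; exists a. Qed.

Lemma section_neq1P {X : Type} (E : set (X * X)) (A : set X) x :
  E (x, x) -> A x ->
  A `&` xsection E x <> [set x] <-> exists y, [/\ A y, y <> x & E (x, y)].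
Proof.
move=> Exx Ax; split=> [neq|[y [Ay yx Exy]] eq]; last first.
  by apply: yx; rewrite -[_ = _]/([set x] y) -eq; split=> //; exact/xsectionP.
apply: contrapT => ney; apply: neq.
apply/seteqP; split=> [y [Ay /xsectionP Exy]|_ ->].
  by apply: contrapT => yx; apply: ney; exists y.
by split=> //; exact/xsectionP.
Qed.

Definition cellular_base {X : Type} (BB : set (set (X * X))) :=
  [/\ forall E, BB E -> equivalence_set E,
      forall E F, BB E -> BB F -> exists G, [/\ BB G, E `<=` G & F `<=` G]
    & forall x y, exists2 E, BB E & E (x, y)].

Definition coarse_gen {X : Type} (BB : set (set (X * X))) :=
  [set E | entourage_on E /\ exists2 B, BB B & E `<=` B].

Section coarse_gen.
Context {X : Type} {BB : set (set (X * X))} (BBP : cellular_base BB).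

Lemma coarse_gen_base : coarse_base (coarse_gen BB) BB.
Proof.
have [BBeq _ _] := BBP; split=> [E BE|E [_ //]].
by split; [exact: equivalence_entourage (BBeq _ BE)|exists E].
Qed.

Lemma coarse_gen_cellular : cellular (coarse_gen BB).
Proof.
by exists BB; [exact: coarse_gen_base|have [BBeq _ _] := BBP; exact: BBeq].
Qed.

Lemma coarse_gen_structure : coarse_structure (coarse_gen BB).
Proof.
have [BBeq BBdir BBcov] := BBP; split.
- by move=> E [].
- apply/seteqP; split=> // -[x y] _; have [E BE Exy] := BBcov x y.
  by exists E => //; have [h _] := coarse_gen_base; exact: h.
- move=> E F [_ [B BBB EB]] [_ [C BC FC]].
  have [G [BG BsG CG]] := BBdir _ _ BBB BC.
  exists G; first by have [h _] := coarse_gen_base; exact: h.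
  have Geq := BBeq _ BG.
  move=> [x z] [y /= /EB/BsG Gxy /FC/CG Gzy].
  exact: (equivalence_set_trans Geq Gxy (equivalence_set_sym Geq Gzy)).
- move=> E F [_ [B BBB EB]] Fent FE; split=> //; exists B => //.
  exact: subset_trans EB.
Qed.

End coarse_gen.

Lemma coarse_structure_union {X : Type} (EE : set (set (X * X))) E F :
  coarse_structure EE -> EE E -> EE F ->
  exists T, [/\ EE T, E `<=` T & F `<=` T].
Proof.
move=> [ent _ comp down] EE_E EE_F.
have EE_d : EE diagonal by apply: (down E) => //; exact: ent.
have [T1 EE_T1 T1P] := comp _ _ EE_d EE_F.
have [T EE_T TP] := comp _ _ EE_E EE_T1.
exists T; split=> // -[x y] Exy; apply: TP.
  by exists y => //; apply: ent EE_T1 _ _.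
exists x; first exact: ent EE_E _ _.
by apply: T1P; exists y => //.
Qed.

Section bounded.
Context (CC : set (set (nat * nat))).

Lemma bounded_finite A :
  CC `<=` E_omega1 -> coarse_bounded CC A -> finite_set A.
Proof.
move=> CE [E [x [/CE[_ /(_ x)[Efin _]] AE]]]; exact: sub_finite_set AE Efin.
Qed.

Lemma finite_bounded A :
  coarse_structure CC -> finite_set A -> coarse_bounded CC A.
Proof.
move=> CCs /finite_set_sub_II[n An].
suff [E CE En] : exists2 E, CC E & `I_n `<=` xsection E 0.
  by exists E, 0; split=> //; exact: subset_trans An En.
have cov x y : exists2 E, CC E & E (x, y).
  have [_ cup _ _] := CCs; have : [set: nat * nat] (x, y) by [].
  by rewrite -cup => -[E CE Exy]; exists E.
elim: {An} n => [|n [E CE En]]; first by have [E CE _] := cov 0 0; exists E.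
have [F CF F0n] := cov 0 n.
have [T [CT ET FT]] := coarse_structure_union CCs CE CF.
exists T => // k /=; rewrite ltnS leq_eqVlt => /orP[/eqP ->|/En].
  by apply/xsectionP; exact: FT.
exact: xsection_sub.
Qed.

Lemma unboundedP A : CC `<=` E_omega1 -> coarse_structure CC ->
  coarse_unbounded CC A <-> infinite_set A.
Proof.
move=> CE CCs; split=> nA fA; apply: nA; first exact: finite_bounded.
exact: bounded_finite.
Qed.

End bounded.

Lemma E_omega_omega1 : E_omega `<=` E_omega1.
Proof.
move=> E [Eent [n En]]; split=> // x; have [h1 h2] := En x.
by split; apply/finite_set_leP; exists n.
Qed.

Lemma coarse_gen_sub_omega BB : BB `<=` E_omega -> coarse_gen BB `<=` E_omega.
Proof.
move=> BE E [Eent [B /BE[_ [n Bn]] EB]]; split=> //; exists n => x.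
have [h1 h2] := Bn x; split; [apply: card_le_trans h1|apply: card_le_trans h2];
  apply: subset_card_le; apply: xsection_sub => // -[y z] /=; exact: EB.
Qed.

Lemma coarse_gen_sub_omega1 BB :
  BB `<=` E_omega1 -> coarse_gen BB `<=` E_omega1.
Proof.
move=> BE E [Eent [B /BE[_ Bn] EB]]; split=> // x.
have [h1 h2] := Bn x.
split; [apply: sub_finite_set h1|apply: sub_finite_set h2];
  apply: xsection_sub => // -[y z] /=; exact: EB.
Qed.

Lemma equivalence_omega E n : equivalence_set E ->
  (forall x, xsection E x #<= `I_n) -> E_omega E.
Proof.
move=> Eeq En; split; first exact: equivalence_entourage.
by exists n => x; rewrite (equivalence_set_inv Eeq).
Qed.

Lemma equivalence_omega1 E : equivalence_set E ->
  (forall x, finite_set (xsection E x)) -> E_omega1 E.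
Proof.
move=> Eeq En; split; first exact: equivalence_entourage.
by move=> x; rewrite (equivalence_set_inv Eeq).
Qed.

(** If A is discrete, then the two halves of A are separated: a cell of an
    equivalence relation meeting both of them contains two points of A. *)
Lemma inseparated_indiscrete CC : CC `<=` E_omega1 -> coarse_structure CC ->
  cellular CC -> inseparated CC -> indiscrete CC.
Proof.
move=> CE CCs [BB [BC BBcof] BBeq] [unb insep]; split=> // A Adisc.
apply: contrapT => /(unboundedP _ CE CCs)/infinite_injection[e [einj eA]].
pose even_half := range (e \o double).
pose odd_half := range (fun n => e n.*2.+1).
apply: insep; exists even_half, odd_half; split.
- apply/(unboundedP _ CE CCs)/range_infinite.
  exact: inj_comp einj double_inj.
- by apply/(unboundedP _ CE CCs)/range_infinite => m n /einj[]/double_inj.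
move=> E CE_E; have [B BBB EB] := BBcof _ CE_E.
have Beq : equivalence_set B by exact: BBeq.
apply: finite_bounded => //.
have := bounded_finite CE (Adisc _ (BC _ BBB)).
set S := (X in finite_set X) => Sfin.
apply: (@sub_finite_set _ _ (\bigcup_(s in S) xsection B s)); last first.
  by apply: bigcup_finite => // s _; have [_ /(_ s)[]] := CE _ (BC _ BBB).
move=> x [/(thickening_sub EB)/thickeningP[_ [m _ <-] Bmx]].
move=> /(thickening_sub EB)/thickeningP[_ [n _ <-] Bnx] /=.
exists (e m.*2); last exact/xsectionP.
split; first exact: eA.
apply/section_neq1P; [exact: (equivalence_set_refl Beq)|exact: eA|].
exists (e n.*2.+1); split; first exact: eA.
  by move=> /einj /(congr1 odd); rewrite /= !odd_double.
exact: (equivalence_set_trans Beq Bmx (equivalence_set_sym Beq Bnx)).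
Qed.

(** * There is no large cellular structure of bounded geometry *)

Lemma ball_bound E : E_omega1 E -> exists f : nat -> nat,
  forall n x y, x <= n -> E (x, y) \/ E (y, x) -> y <= f n.
Proof.
move=> [_ Efin].
have /choice[g gP] x : exists m, forall y, E (x, y) \/ E (y, x) -> y <= m.
  have : finite_set (xsection E x `|` xsection (E^-1)%relation x).
    by rewrite finite_setU; exact: Efin.
  move=> /finite_seqP[s sE]; exists (\max_(i <- s) i) => y Exy.
  apply: leq_bigmax_seq => //; suff : [set` s] y by [].
  by rewrite -sE; case: Exy => Exy; [left|right]; exact/xsectionP.
exists (fun n => \max_(i < n.+1) g i) => n x y xn /gP /leq_trans; apply.
by rewrite -ltnS in xn; exact: (leq_bigmax (Ordinal xn)).
Qed.

(** In the line, viewed as the square of the line, every column is large.  Once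
    E_k witnesses this for the first k columns, each of its cells contains
    points of k disjoint sets. *)
Lemma large_big_cells CC BB : CC `<=` E_omega1 -> coarse_structure CC ->
  coarse_base CC BB -> (forall B, BB B -> equivalence_set B) -> large CC ->
  exists E : nat -> set (nat * nat), [/\ forall k, BB (E k),
    forall k l, k <= l -> E k `<=` E l
    & forall k x, `I_k #<= xsection (E k) x].
Proof.
move=> CE CCs [BC BBcof] BBeq [unb lrg].
have cofin E F : CC E -> CC F -> exists G, [/\ BB G, E `<=` G & F `<=` G].
  move=> CE_E CE_F.
  have [T [CE_T ET FT]] := coarse_structure_union CCs CE_E CE_F.
  have [G BG TG] := BBcof _ CE_T.
  by exists G; split=> //; [move: ET|move: FT] => /subset_trans; exact.
pose A (i : nat) := range (fun n : nat => pickle (i, n)).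
have Alarge i : large_set CC (A i).
  apply: lrg; apply/(unboundedP _ CE CCs)/range_infinite.
  by move=> m n /(pcan_inj pickleK)[].
have [B0 BB0] : exists B, BB B.
  have [E CE_E _] := Alarge 0; have [G [BG _ _]] := cofin _ _ CE_E CE_E.
  by exists G.
have /choice[step stepP] (p : nat * set (nat * nat)) : exists B', BB p.2 ->
    [/\ BB B', p.2 `<=` B' & forall x, exists2 a, A p.1 a & B' (x, a)].
  case: p => i B /=; have [BBB|] := pselect (BB B); last by exists set0.
  have [E CE_E Elarge] := Alarge i.
  have [G [BG BsG EG]] := cofin _ _ (BC _ BBB) CE_E.
  exists G => _; split=> // x.
  have : thickening E (A i) x by rewrite Elarge.
  move=> /thickeningP[a Aa /EG Gax]; exists a => //.
  exact: (equivalence_set_sym (BBeq _ BG)).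
pose E := fix E k := if k is k'.+1 then step (k', E k') else B0.
have BE k : BB (E k) by elim: k => // k IH; have [] := stepP (k, E k) IH.
have ES k : E k `<=` E k.+1 by have [] := stepP (k, E k) (BE k).
have Emono k l : k <= l -> E k `<=` E l.
  move=> /subnK <-; elim: (l - k) => // m IH; exact: subset_trans IH (ES _).
exists E; split=> // k x.
have /choice[h hP] i : exists a, i < k -> A i a /\ E k (x, a).
  have [ik|] := boolP (i < k); last by exists 0.
  have [_ _ /(_ x)[a Aa Exa]] := stepP (i, E i) (BE i).
  by exists a => _; split=> //; apply: (Emono _ _ ik).
apply: (inj_on_card_le (f := h)) => [i /hP[_ Exh]|i j /hP[hi _] /hP[hj _] hij].
  exact/xsectionP.
move: hi hj; rewrite hij => -[m _ <-] [n _ /(pcan_inj pickleK)[]//].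
Qed.

(** Let E_0, E_1, ... be increasing members of the base such that all cells of
    E_k have at least k points, and let A be so sparse that almost every cell
    of each E_k contains at most one point of A.  If A were large, witnessed by
    cells with at most n points, then a cell C of a common coarsening with
    E_(n+1), far away from 0, would have at most n points for each point of A
    in C, and at least n+1 of them. *)
Lemma no_large_omega CC : CC `<=` E_omega -> coarse_structure CC ->
  cellular CC -> ~ large CC.
Proof.
move=> CEo CCs [BB [BC BBcof] BBeq'] CClarge.
have BBeq B : BB B -> equivalence_set B by exact: BBeq'.
have CE : CC `<=` E_omega1 by exact: subset_trans CEo E_omega_omega1.
have [E [BE Emono Ebig]] := large_big_cells CE CCs (conj BC BBcof) BBeq CClarge.
have /choice[f fP] (k : nat) := ball_bound (CE _ (BC _ (BE k))).
pose a := fix a j := if j is j'.+1 then (maxn (a j') (f j (a j'))).+1 else 0.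
have aS j : a j < a j.+1 by rewrite /= ltnS leq_maxl.
have amono := leq_mono (homo_ltn ltn_trans aS).
have ainj : injective a := incn_inj amono.
have afar k i j : k <= j -> i < j -> ~ E k (a i, a j).
  case: j => // j kj ij /(Emono _ _ kj) Eij.
  have ai : a i <= a j by rewrite amono.
  have := fP j.+1 _ _ _ ai (or_introl Eij).
  by rewrite leqNgt /= ltnS leq_maxr.
have [_ lrg] := CClarge.
have [|U CU Ularge] := lrg (range a).
  exact/(unboundedP _ CE CCs)/range_infinite.
have [B BBB UB] := BBcof _ CU; have Beq := BBeq _ BBB.
have Bcov x : exists j, B (x, a j).
  have : thickening U (range a) x by rewrite Ularge.
  move=> /thickeningP[_ [j _ <-] /UB Bx]; exists j.
  exact: (equivalence_set_sym Beq).
have [_ [n Bn]] := CEo _ (BC _ BBB).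
have [T [CT BT ET]] := coarse_structure_union CCs (BC _ BBB) (BC _ (BE n.+1)).
have [G BG TG] := BBcof _ CT; have Geq := BBeq _ BG.
have BsG : B `<=` G by exact: subset_trans BT TG.
have EG : E n.+1 `<=` G by exact: subset_trans ET TG.
have Eeq := BBeq _ (BE n.+1).
have [g gP] := ball_bound (CE _ (BC _ BG)).
pose x0 := (g (a n)).+1; pose S := [set j | G (x0, a j)].
have Sn j : S j -> n < j.
  move=> Gx; rewrite ltnNge; apply/negP => jn.
  have aj : a j <= a n by rewrite amono.
  by have := gP _ _ _ aj (or_intror Gx); rewrite ltnn.
have [m Sm] : exists m, S #= `I_m.
  apply/finite_setP; apply: (@sub_finite_set _ _ (a @^-1` xsection G x0)).
    by move=> j Sj; exact/xsectionP.
  apply: finite_preimage => [i j _ _ /ainj//|].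
  by have [_ /(_ x0)[]] := CE _ (BC _ BG).
have m0 : 0 < m.
  have [j Bj] := Bcov x0; rewrite lt0n; apply/negP => /eqP m0.
  move: Sm; rewrite m0 II0 card_eq0 => /eqP S0.
  have : S j by exact: BsG.
  by rewrite S0.
move: Sm; rewrite card_eq_le => /andP[SI IS].
have [r [rm rinj]] := card_le_inj_on 0 SI.
have [r' [rS rinj']] := card_le_inj_on 0 IS.
have lower : `I_(m * n.+1) #<= xsection G x0.
  have /choice[h hP] j := card_le_inj_on 0 (Ebig n.+1 (a j)).
  have hE t : E n.+1 (a (r' (t %/ n.+1)), h (r' (t %/ n.+1)) (t %% n.+1)).
    have [+ _] := hP (r' (t %/ n.+1)) => /(_ (t %% n.+1) (ltn_pmod _ _)).
    by move=> /(_ isT)/xsectionP.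
  have tm t : t < m * n.+1 -> t %/ n.+1 < m by rewrite ltn_divLR.
  apply: (inj_on_card_le
      (f := fun t => h (r' (t %/ n.+1)) (t %% n.+1))) => [t /tm|t t' /tm + /tm].
    move=> /rS Sr; apply/xsectionP.
    exact: (equivalence_set_trans Geq Sr (EG _ (hE t))).
  move=> tm1 tm2 htt'; have := hE t'.
  rewrite -htt' => /(equivalence_set_sym Eeq).
  move=> /(equivalence_set_trans Eeq (hE t)) => Ett'.
  have rr : r' (t %/ n.+1) = r' (t' %/ n.+1).
    have [S1 S2] := (Sn _ (rS _ tm1), Sn _ (rS _ tm2)).
    have [lt|lt|//] := ltngtP (r' (t %/ n.+1)) (r' (t' %/ n.+1)).
      by have := afar _ _ _ S2 lt.
    by have := afar _ _ _ S1 lt => /(_ (equivalence_set_sym Eeq Ett')).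
  rewrite (divn_eq t n.+1) (divn_eq t' n.+1) (rinj' _ _ tm1 tm2 rr).
  move: htt'; rewrite rr; have [_ hinj] := hP (r' (t' %/ n.+1)).
  by move=> /hinj -> //; exact: ltn_pmod.
have upper : xsection G x0 #<= `I_(m * n).
  have /choice[j jP] := Bcov.
  have /choice[u uP] i := card_le_inj_on 0 (Bn (a i)).1.
  have jS x : xsection G x0 x -> S (j x).
    move=> /xsectionP Gx.
    exact: (equivalence_set_trans Geq Gx (BsG _ (jP x))).
  have jB x : xsection B (a (j x)) x.
    by apply/xsectionP; exact: (equivalence_set_sym Beq).
  have un x : u (j x) x < n by have [h _] := uP (j x); exact: h.
  apply: (inj_on_card_le
      (f := fun x => r (j x) * n + u (j x) x)) => [x|x y] Gx /=.
    apply: (@leq_trans (r (j x) * n + n)); first by rewrite ltn_add2l.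
    by rewrite -mulSnr leq_mul2r rm ?orbT//; exact: jS.
  move=> Gy E1; have n0 : 0 < n by exact: leq_ltn_trans (un x).
  have rr : r (j x) = r (j y).
    by move/(congr1 (divn^~ n)): E1; rewrite !divnMDl// !divn_small// !addn0.
  have jj : j x = j y by apply: rinj rr; exact: jS.
  move: E1; rewrite rr => /addnI; rewrite jj.
  by have [_ h] := uP (j y); apply: h => //; rewrite -jj.
have := card_le_trans lower upper.
by rewrite card_le_II leq_pmul2l// ltnn.
Qed.

(** * The lower bounds b and d *)

Lemma le_starP f g : le_star f g <-> exists N, forall n, N <= n -> f n <= g n.
Proof. by split=> [[N _ NP]|[N NP]]; exists N. Qed.

Lemma b_cardP :
  (~ exists g, forall f, b_card f -> le_star f g) /\
  forall B, (~ exists g, forall f, B f -> le_star f g) -> b_card #<= B.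
Proof.
apply: min_cardP; exists [set: nat -> nat] => -[g /(_ (fun n => (g n).+1) I)].
by move=> /le_starP[N /(_ N (leqnn N))]; rewrite ltnn.
Qed.

Lemma d_cardP :
  (forall f, exists2 g, d_card g & le_star f g) /\
  forall D, (forall f, exists2 g, D g & le_star f g) -> d_card #<= D.
Proof.
apply: min_cardP; exists [set: nat -> nat] => f; exists f => //.
by apply/le_starP; exists 0.
Qed.

Lemma b_le_continuum : b_card #<= continuum.
Proof. by apply: card_le_trans card_sequences; apply: card_leT. Qed.

Lemma d_le_continuum : d_card #<= continuum.
Proof. by apply: card_le_trans card_sequences; apply: card_leT. Qed.

(** Since g eventually bounds the balls of E, the ball of a i, for large i, does
    not reach a i.+1, and by symmetry it contains no smaller a j except for
    finitely many j. *)
Lemma sparse_discrete CC g a : CC `<=` E_omega1 -> coarse_structure CC ->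
  (forall i, maxn (a i) (g (a i)) < a i.+1) ->
  (forall E, CC E -> exists f, le_star f g /\
    forall n x y, x <= n -> E (x, y) \/ E (y, x) -> y <= f n) ->
  coarse_discrete CC (range a).
Proof.
move=> CE CCs aS CCg E CE_E; apply: finite_bounded => //.
have aS' i : a i < a i.+1 by have := aS i; rewrite gtn_max => /andP[].
have amono := leq_mono (homo_ltn ltn_trans aS').
have [f [/le_starP[N Nfg] fP]] := CCg _ CE_E.
have E_refl x : E (x, x) by have [ent _ _ _] := CCs; exact: ent CE_E _ _.
have skip i j : N <= a i -> i < j -> f (a i) < a j.
  move=> Ni ij; apply: (leq_ltn_trans (Nfg _ Ni)).
  apply: (@leq_trans (a i.+1)); last by rewrite amono.
  by have := aS i; rewrite gtn_max => /andP[].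
apply: (@sub_finite_set _ _ `I_(maxn N (f N)).+1); last exact: finite_II.
have ra i : range a (a i) by exists i.
move=> _ [[i _ <-] /(section_neq1P (E_refl _) (ra i))[_ [[j _ <-] ij Eij]]].
have {}ij : i != j by apply/eqP => ij'; apply: ij; rewrite ij'.
rewrite /= ltnS leq_max; have [//|/ltnW Ni] := leqP (a i) N; apply/orP; right.
have [lt|lt|E1] := ltngtP i j; last by rewrite E1 eqxx in ij.
  by have := fP _ _ _ (leqnn _) (or_introl Eij); rewrite leqNgt skip.
have [jN|/ltnW Nj] := leqP (a j) N; first exact: fP jN (or_intror Eij).
by have := fP _ _ _ (leqnn _) (or_intror Eij); rewrite leqNgt skip.
Qed.

Lemma b_le_weight CC : CC `<=` E_omega1 -> coarse_structure CC ->
  indiscrete CC -> b_card #<= weight CC.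
Proof.
move=> CE CCs [_ ind]; have [BC BBcof] := weight_base CC.
have /choice[F FP] (E : set (nat * nat)) : exists f : nat -> nat, CC E ->
    forall n x y, x <= n -> E (x, y) \/ E (y, x) -> y <= f n.
  have [/CE/ball_bound[f fP]|n] := pselect (CC E); first by exists f.
  by exists id.
apply: card_le_trans (card_image_le F _); have [_] := b_cardP; apply.
move=> [g gP].
pose a := fix a i := if i is j.+1 then (maxn (a j) (g (a j))).+1 else 0.
have aS i : maxn (a i) (g (a i)) < a i.+1 by [].
have /ind : coarse_discrete CC (range a).
  apply: (sparse_discrete CE CCs aS) => E /BBcof[B BBB EB]; exists (F B); split.
    by apply: gP; exists B.
  move=> n x y xn Exy; apply: (FP _ (BC _ BBB) _ _ _ xn).
  by case: Exy => /EB; [left|right].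
move=> /(bounded_finite CE); apply: range_infinite.
have aS' i : a i < a i.+1 by have := aS i; rewrite gtn_max => /andP[].
exact: incn_inj (leq_mono (homo_ltn ltn_trans aS')).
Qed.

(** If f bounds the balls of E, then every point E-related to f n + 1 is greater
    than n and at most f (f n + 1).  A set A that is large by means of E has
    such a point, and iterating this bounds the enumeration of A by a function
    of f. *)
Lemma d_le_weight CC : CC `<=` E_omega1 -> coarse_structure CC ->
  large CC -> d_card #<= weight CC.
Proof.
move=> CE CCs [_ lrg]; have [BC BBcof] := weight_base CC.
have /choice[F FP] (E : set (nat * nat)) : exists f : nat -> nat, CC E ->
    forall n x y, x <= n -> E (x, y) \/ E (y, x) -> y <= f n.
  have [/CE/ball_bound[f fP]|n] := pselect (CC E); first by exists f.
  by exists id.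
pose next E n := F E (F E n).+1.
pose H E i := iter i.+1 (next E) 0.
apply: card_le_trans (card_image_le H _); have [_] := d_cardP; apply => g.
pose a := fix a i := if i is j.+1 then (maxn (a j) (g i)).+1 else g 0.
have aS i : a i < a i.+1 by rewrite /= ltnS leq_maxl.
have ag i : g i <= a i by case: i => //= i; rewrite -ltnS ltnS leqW// leq_maxr.
have amono := leq_mono (homo_ltn ltn_trans aS).
have [|U CU Ularge] := lrg (range a).
  exact/(unboundedP _ CE CCs)/range_infinite/(incn_inj amono).
have [E BE UE] := BBcof _ CU; have fP := FP _ (BC _ BE).
have hit n : exists j, n < a j <= next E n.
  have : thickening U (range a) (F E n).+1 by rewrite Ularge.
  move=> /thickeningP[_ [j _ <-] /UE Ej]; exists j; apply/andP; split.
    rewrite ltnNge; apply/negP => jn.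
    by have := fP _ _ _ jn (or_introl Ej); rewrite ltnn.
  exact: fP (leqnn _) (or_intror Ej).
exists (H E); first by exists E.
apply/le_starP; exists 0 => i _; apply: (leq_trans (ag i)).
elim: i => [|i IH].
  by have [j /andP[_]] := hit 0; apply: leq_trans; rewrite amono.
have [j /andP[ij jH]] := hit (H E i); apply: leq_trans jH.
rewrite amono -(leqW_mono amono); exact: leq_ltn_trans IH ij.
Qed.

(** * Towers of sparse sets and interval structures *)

Lemma infinite_nat_ge s : infinite_set s -> forall n, exists2 y, s y & n <= y.
Proof.
move=> sinf n; apply: contrapT => nex; apply: sinf.
apply: (@sub_finite_set _ _ `I_n); last exact: finite_II.
move=> y sy /=; rewrite ltnNge; apply/negP => ny; apply: nex; by exists y.
Qed.

Lemma infinite_next s : infinite_set s -> forall x,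
  exists y, [/\ s y, x < y & forall c, s c -> x < c -> y <= c].
Proof.
move=> sinf x; have [y0 sy0 xy0] := infinite_nat_ge sinf x.+1.
have ex : exists y, `[< s y >] && (x < y).
  by exists y0; rewrite xy0 andbT; exact/asboolP.
case: (ex_minnP ex) => y /andP[/asboolP sy xy] ymin.
exists y; split=> // c sc xc.
by apply: ymin; rewrite xc andbT; exact/asboolP.
Qed.

Lemma nat_prev (s : set nat) c0 x : s c0 -> c0 <= x ->
  exists y, [/\ s y, y <= x & forall c, s c -> c <= x -> c <= y].
Proof.
move=> sc0 cx0; have ex : exists y, `[< s y >] && (y <= x).
  by exists c0; rewrite cx0 andbT; exact/asboolP.
have bd y : `[< s y >] && (y <= x) -> y <= x by move=> /andP[].
case: (ex_maxnP ex bd) => y /andP[/asboolP sy xy] ymax.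
exists y; split=> // c sc xc.
by apply: ymax; rewrite xc andbT; exact/asboolP.
Qed.

(** The values of f on the whole segment below x are taken into account because
    f need not be monotone. *)
Definition sparse (f : nat -> nat) (P : set nat) :=
  forall k x y, P x -> P y -> x < y -> k <= x -> f k < y.

Lemma sparse_subset f s : infinite_set s ->
  exists P, [/\ infinite_set P, P `<=` s & sparse f P].
Proof.
move=> sinf; pose m x := maxn x (\max_(k < x.+1) f k).
have /choice[nxt nxtP] x : exists y, s y /\ m x < y.
  by have [y sy my] := infinite_nat_ge sinf (m x).+1; exists y.
pose h i := iter i.+1 nxt 0.
have hS i : m (h i) < h i.+1 by have [] := nxtP (h i).
have hS' i : h i < h i.+1 by have := hS i; rewrite gtn_max => /andP[].
have hmono := leq_mono (homo_ltn ltn_trans hS').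
exists (range h); split.
- exact/range_infinite/(incn_inj hmono).
- by move=> _ [i _ <-]; have [] := nxtP (iter i nxt 0).
- move=> k _ _ [i _ <-] [j _ <-]; rewrite (leqW_mono hmono) => ij ki.
  apply: (@leq_trans (h i.+1)); last by rewrite hmono.
  apply: leq_ltn_trans (hS i); rewrite leq_max; apply/orP; right.
  by rewrite -ltnS in ki; exact: (leq_bigmax (Ordinal ki)).
Qed.

Lemma pseudo_intersection (T : set (set nat)) :
  (forall t, T t -> infinite_set t) -> total_on T subset_star ->
  ~ (t_card #<= T) ->
  exists2 s, infinite_set s & forall t, T t -> subset_star s t.
Proof.
move=> Tinf Ttot nT; apply: contrapT => nex; apply: nT.
have TT : [set T | [/\ forall t, T t -> infinite_set t,
    total_on T subset_star
    & forall s, infinite_set s -> exists2 t, T t & ~ subset_star s t]] T.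
  split=> // s sinf; apply: contrapT => ns; apply: nex; exists s => // t Tt.
  by apply: contrapT => nst; apply: ns; exists t.
by have [_ h] := min_cardP (ex_intro _ T TT); exact: h.
Qed.

(** In a well-order of F whose initial segments have fewer than t elements, the
    sets chosen so far always have a pseudo-intersection, which is thinned out
    to be sparse for the next function. *)
Lemma sparse_tower (F : set (nat -> nat)) : F #<= t_card ->
  exists P : F -> set nat, [/\ forall i, infinite_set (P i),
    forall i, sparse (val i) (P i)
    & forall i j, subset_star (P i) (P j) \/ subset_star (P j) (P i)].
Proof.
move=> Ft; have [R [Rwo Rsmall]] := exists_initial_well_order F.
have [Rwf Rtr Rtri] := Rwo.
pose Q (i : F) (P : F -> set nat) (v : set nat) := [/\ infinite_set v,
  sparse (val i) v & forall j, R j i -> subset_star v (P j)].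
have [||P PQ] := @transfinite_choice _ _ R Q set0 Rwo.
- move=> i P P' v PP' [v1 v2 v3]; split=> // j ji; rewrite -PP'//; exact: v3.
- move=> i P IH; pose T := P @` [set j | R j i].
  have [|||s sinf sT] := @pseudo_intersection T.
  + by move=> _ [j ji <-]; have [] := IH _ ji.
  + move=> _ _ [j ji <-] [k ki <-]; have [jk|<-|kj] := Rtri j k.
    * by right; have [_ _ h] := IH _ ki; exact: h.
    * by left; rewrite /subset_star setDv; exact: finite_set0.
    * by left; have [_ _ h] := IH _ ji; exact: h.
  + move=> tT; apply: (Rsmall i); rewrite (card_le_eql (card_setT F)).
    apply: card_le_trans Ft _; apply: card_le_trans tT _; exact: card_image_le.
  have [v [vinf vs vsp]] := sparse_subset (val i) sinf.
  exists v; split=> // j ji; apply: (@sub_finite_set _ _ (s `\` P j)).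
    by move=> x [/vs sx nPx].
  by apply: sT; exists j.
exists P; split=> [i|i|i j]; [by have [] := PQ i|by have [] := PQ i|].
have [ij|->|ji] := Rtri i j.
- by right; have [_ _ h] := PQ j; exact: h.
- by left; rewrite /subset_star setDv; exact: finite_set0.
- by left; have [_ _ h] := PQ i; exact: h.
Qed.

(** The cells are the intervals into which P cuts the line, each starting at a
    point of P except possibly for the first. *)
Definition cut_rel (P : set nat) : set (nat * nat) :=
  [set p | forall c, P c -> (c <= p.1) = (c <= p.2)].

Definition tail (P : set nat) n := P `&` [set c | n <= c].

Lemma tail0 P : tail P 0 = P.
Proof. by apply/seteqP; split=> [x []|x Px]. Qed.

Lemma cut_rel_equivalence P : equivalence_set (cut_rel P).
Proof.
split=> [x c//|x y xy c Pc|x y z xy yz c Pc]; first by rewrite [RHS]xy.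
by rewrite [LHS]xy// [LHS]yz.
Qed.

Lemma cut_rel_sub P P' : P `<=` P' -> cut_rel P' `<=` cut_rel P.
Proof. by move=> PP' p h c /PP'; exact: h. Qed.

Lemma cut_rel_omega1 P : infinite_set P -> E_omega1 (cut_rel P).
Proof.
move=> Pinf; apply: equivalence_omega1; first exact: cut_rel_equivalence.
move=> x; have [c Pc xc] := infinite_nat_ge Pinf x.+1.
apply: (@sub_finite_set _ _ `I_c); last exact: finite_II.
by move=> y /xsectionP /(_ c Pc) /=; rewrite leqNgt xc ltnNge => <-.
Qed.

Lemma cut_rel_between P p p' x y : (forall c, P c -> p < c -> p' <= c) ->
  p <= x < p' -> p <= y < p' -> cut_rel P (x, y).
Proof.
move=> between /andP[px xp] /andP[py yp] c Pc /=.
have [cp|pc] := leqP c p; first by rewrite (leq_trans cp px) (leq_trans cp py).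
have p'c := between _ Pc pc.
by rewrite leqNgt (leq_trans xp p'c) leqNgt (leq_trans yp p'c).
Qed.

Lemma tail_infinite P n : infinite_set P -> infinite_set (tail P n).
Proof.
move=> Pinf fin; apply: Pinf; apply: (@sub_finite_set _ _ (tail P n `|` `I_n)).
  by move=> x Px; have [nx|xn] := leqP n x; [left|right].
by rewrite finite_setU; split=> //; exact: finite_II.
Qed.

(** If P is almost included in P', then deleting the finitely many points of
    P outside P' leaves a set whose intervals are unions of intervals cut by
    P'.  So the tails of the members of a tower are directed. *)
Lemma cut_rel_base (I : Type) (i0 : I) (P : I -> set nat) :
  (forall i j, subset_star (P i) (P j) \/ subset_star (P j) (P i)) ->
  cellular_base [set cut_rel (tail (P p.1) p.2) | p in [set: I * nat]].
Proof.
move=> Ptot; split.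
- by move=> _ [p _ <-]; exact: cut_rel_equivalence.
- move=> _ _ [[i m] _ <-] [[j n] _ <-] /=.
  wlog ij : i j m n / subset_star (P i) (P j).
    move=> H; have [/H|/H] := Ptot i j; first exact.
    by move=> /(_ n m)[G [? ? ?]]; exists G.
  have [N PN] := finite_set_sub_II ij.
  exists (cut_rel (tail (P i) (maxn N (maxn m n)))); split.
  + by exists (i, maxn N (maxn m n)).
  + by apply: cut_rel_sub => x [Px /=]; rewrite !geq_max => /and3P[_ ? _].
  + apply: cut_rel_sub => x [Px /=].
    rewrite !geq_max => /and3P[Nx _ nx]; split=> //.
    by apply: contrapT => nPx; have /= := PN x (conj Px nPx); rewrite ltnNge Nx.
- move=> x y; exists (cut_rel (tail (P i0) (maxn x y).+1)).
    by exists (i0, (maxn x y).+1).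
  move=> c [_ /=]; rewrite gtn_max => /andP[xc yc].
  by rewrite leqNgt xc leqNgt yc.
Qed.

Lemma tower_structure (F : set (nat -> nat)) : infinite_set F -> F #<= t_card ->
  exists CC, [/\ CC `<=` E_omega1, coarse_structure CC, cellular CC,
    weight CC #<= F
    & forall f, F f -> exists P, [/\ infinite_set P, sparse f P
        & forall n, CC (cut_rel (tail P n))]].
Proof.
move=> Finf Ft; have [P [Pinf Psparse Ptot]] := sparse_tower Ft.
have [f0 Ff0] := infinite_setN0 Finf.
have BBP := cut_rel_base (SigSub (mem_set Ff0)) Ptot.
set BB := (X in cellular_base X) in BBP.
exists (coarse_gen BB); split.
- apply: coarse_gen_sub_omega1 => _ [[i n] _ <-].
  by apply: cut_rel_omega1; exact: tail_infinite.
- exact: coarse_gen_structure.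
- exact: coarse_gen_cellular.
- apply: card_le_trans (weight_le (coarse_gen_base BBP)) _.
  apply: card_le_trans (card_image_le _ _) _.
  rewrite -[[set: _ * _]]setXTT; apply: card_le_setX => //.
    by rewrite (card_le_eql (card_setT F)).
  exact/infiniteP.
- move=> f Ff; pose i : F := SigSub (mem_set Ff).
  exists (P i); split=> //; first exact: (Psparse i).
  by move=> n; have [h _] := coarse_gen_base BBP; apply: h; exists (i, n).
Qed.

Lemma b_card_infinite : infinite_set b_card.
Proof.
move=> /finite_seqP[s sE]; have [h _] := b_cardP; apply: h.
exists (fun n => \max_(f <- s) f n) => f; rewrite sE => /= fs.
apply/le_starP; exists 0 => n _.
exact: (@leq_bigmax_seq _ s xpredT (fun f => f n) f).
Qed.

Lemma b_le_d : b_card #<= d_card.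
Proof.
have [dom _] := d_cardP; have [_ h] := b_cardP; apply: h => -[g gP].
have [f df /le_starP[M Mf]] := dom (fun n => (g n).+1).
have /le_starP[N Nf] := gP f df.
have := leq_trans (Mf _ (leq_maxl M N)) (Nf _ (leq_maxr M N)).
by rewrite ltnn.
Qed.

Lemma d_card_infinite : infinite_set d_card.
Proof. by move=> /(card_le_finite b_le_d); exact: b_card_infinite. Qed.

(** Let g n bound the next points of A and of B after n, and let p < p' < p'' be
    consecutive in P.  If no cell beyond p meets both A and B, then p' <= g p
    and p'' <= g p'; as P is f-sparse, this gives f n < p'' <= g (g n)
    whenever p <= n < p', so that f is dominated. *)
Lemma b_structure : t_card #= b_card -> exists CC, [/\ CC `<=` E_omega1,
  coarse_structure CC, inseparated CC, cellular CC & weight CC #<= b_card].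
Proof.
rewrite card_eq_le => /andP[_ bt].
have [CC [CE CCs CCc CCw CCP]] := tower_structure b_card_infinite bt.
exists CC; split=> //; split; first exact/(unboundedP _ CE CCs)/infinite_nat.
move=> [A [B [/(unboundedP _ CE CCs) Ainf /(unboundedP _ CE CCs) Binf sep]]].
have /choice[g0 g0P] n : exists m, (exists2 a, A a & n <= a < m) /\
    (exists2 b, B b & n <= b < m).
  have [a Aa na] := infinite_nat_ge Ainf n.
  have [b Bb nb] := infinite_nat_ge Binf n.
  by exists (maxn a b).+1; split; [exists a|exists b];
    rewrite ?na ?nb ?ltnS ?leq_maxl ?leq_maxr.
pose g n := \max_(k < n.+1) g0 k.
have gg0 n : g0 n <= g n by exact: (leq_bigmax (@ord_max n)).
have gmono m n : m <= n -> g m <= g n.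
  move=> mn; apply/bigmax_leqP => k _.
  have kn : k < n.+1 by exact: leq_trans (ltn_ord k) _.
  exact: (leq_bigmax (Ordinal kn)).
have [unb _] := b_cardP; apply: unb; exists (g \o g) => f bf.
have [P [Pinf Psp PCC]] := CCP f bf.
have := PCC 0; rewrite tail0 => CP.
have [N NP] := finite_set_sub_II (bounded_finite CE (sep _ CP)).
have step p p' : N <= p -> (forall c, P c -> p < c -> p' <= c) -> p' <= g p.
  move=> Np between; rewrite leqNgt; apply/negP => gp.
  have [[a Aa /andP[pa ag]] [b Bb /andP[pb bg]]] := g0P p.
  have g0p' : g0 p <= p' by exact: leq_trans (gg0 p) (ltnW gp).
  have pa' : p <= a < p' by rewrite pa (leq_trans ag).
  have pb' : p <= b < p' by rewrite pb (leq_trans bg).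
  have : `I_N a.
    apply: NP; split; apply/thickeningP; [exists a|exists b] => //.
  exact: (cut_rel_between between pb' pa').
  by rewrite /= ltnNge (leq_trans Np pa).
have [p0 Pp0 Np0] := infinite_nat_ge Pinf N.
apply/le_starP; exists p0 => n p0n.
have [p [Pp pn pmax]] := nat_prev Pp0 p0n.
have Np : N <= p by exact: leq_trans Np0 (pmax _ Pp0 p0n).
have [p' [Pp' pp' p'min]] := infinite_next Pinf p.
have [p'' [Pp'' pp'' p''min]] := infinite_next Pinf p'.
have np' : n <= p'.
  rewrite leqNgt; apply/negP => p'n.
  by have := pmax _ Pp' (ltnW p'n); rewrite leqNgt pp'.
apply/ltnW/(leq_trans (Psp _ _ _ Pp' Pp'' pp'' np')).
apply: (leq_trans (step p' p'' (leq_trans Np (ltnW pp')) p''min)).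
exact: gmono (leq_trans (step _ _ Np p'min) (gmono _ _ pn)).
Qed.

(** If f eventually dominates the function g that bounds the next point of A,
    then the intervals cut by an f-sparse set P contain a point of A beyond
    some p0 in P.  The tail of P from p0 on merges all points below p0 into one
    cell, and p0 is chosen so that this cell contains a point of A as well. *)
Lemma d_structure : t_card #= d_card -> exists CC, [/\ CC `<=` E_omega1,
  coarse_structure CC, large CC, cellular CC & weight CC #<= d_card].
Proof.
rewrite card_eq_le => /andP[_ dt].
have [CC [CE CCs CCc CCw CCP]] := tower_structure d_card_infinite dt.
exists CC; split=> //; split; first exact/(unboundedP _ CE CCs)/infinite_nat.
move=> A /(unboundedP _ CE CCs) Ainf.
have /choice[g gP] n : exists m, exists2 a, A a & n <= a < m.
  have [a Aa na] := infinite_nat_ge Ainf n.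
  by exists a.+1, a; rewrite ?na ?ltnSn.
have [dom _] := d_cardP; have [f df /le_starP[N Nf]] := dom g.
have [P [Pinf Psp PCC]] := CCP f df.
have [a0 Aa0] := infinite_setN0 Ainf.
have [p0 Pp0] := infinite_nat_ge Pinf (maxn N a0.+1).
rewrite geq_max => /andP[Np0 ap0].
exists (cut_rel (tail P p0)) => //.
apply/seteqP; split=> // x _; apply/thickeningP.
have [xp0|p0x] := ltnP x p0.
  exists a0 => //; apply: (@cut_rel_between _ 0 p0); rewrite ?leq0n//=.
  by move=> c [].
have [p [[Pp p0p] px pmax]] :=
  @nat_prev (tail P p0) _ _ (conj Pp0 (leqnn p0)) p0x.
have [p' [Pp' pp' p'min]] := infinite_next Pinf p.
have xp' : x < p'.
  rewrite ltnNge; apply/negP => p'x; suff : p' <= p by rewrite leqNgt pp'.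
  by apply: pmax => //; split=> //=; exact: leq_trans p0p (ltnW pp').
have [a Aa /andP[pa ag]] := gP p.
exists a => //; apply: (@cut_rel_between _ p p').
- by move=> c [Pc _]; exact: p'min.
- rewrite pa; apply: (leq_trans ag).
  apply: (leq_trans (Nf _ (leq_trans Np0 p0p))).
  by apply/ltnW/(Psp _ _ _ Pp Pp').
- by rewrite px.
Qed.

(** * Joins of equivalence relations *)

Definition eq_closure (U : set (nat * nat)) : set (nat * nat) :=
  [set p | forall R, equivalence_set R -> U `<=` R -> R p].

Lemma eq_closure_equivalence U : equivalence_set (eq_closure U).
Proof.
split=> [x R Req UR|x y xy R Req UR|x y z xy yz R Req UR].
- exact: (equivalence_set_refl Req).
- exact: (equivalence_set_sym Req (xy _ Req UR)).
- exact: (equivalence_set_trans Req (xy _ Req UR) (yz _ Req UR)).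
Qed.

Lemma sub_eq_closure U : U `<=` eq_closure U.
Proof. by move=> p Up R _; exact. Qed.

Lemma eq_closure_min U R : equivalence_set R -> U `<=` R -> eq_closure U `<=` R.
Proof. by move=> Req UR p; exact. Qed.

Definition join (l : seq (set (nat * nat))) : set (nat * nat) :=
  eq_closure [set p | exists2 F, List.In F l & F p].

Lemma join_equivalence l : equivalence_set (join l).
Proof. exact: eq_closure_equivalence. Qed.

Lemma sub_join l F : List.In F l -> F `<=` join l.
Proof. by move=> Fl p Fp; apply: sub_eq_closure; exists F. Qed.

Lemma join_min l R : equivalence_set R -> (forall F, List.In F l -> F `<=` R) ->
  join l `<=` R.
Proof. by move=> Req lR; apply: eq_closure_min => // p [F /lR]; exact. Qed.

Definition joins (FF : set (set (nat * nat))) :=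
  join @` [set l | List.Forall FF l].

Definition joinable (FF : set (set (nat * nat))) := joins FF `<=` E_omega.

(** These relations, contained in all families considered, ensure that any two
    points are related by some join. *)
Definition square n : set (nat * nat) := `I_n `*` `I_n.

Lemma joins_base FF : range square `<=` FF -> cellular_base (joins FF).
Proof.
move=> sqF; split.
- by move=> _ [l _ <-]; exact: join_equivalence.
- move=> _ _ [l lF <-] [l' lF' <-]; exists (join (l ++ l')); split.
  + by exists (l ++ l') => //=; apply/List.Forall_app.
  + apply: join_min; first exact: join_equivalence.
    by move=> F Fl; apply: sub_join; apply: List.in_or_app; left.
  + apply: join_min; first exact: join_equivalence.
    by move=> F Fl; apply: sub_join; apply: List.in_or_app; right.
- move=> x y; exists (join [:: square (maxn x y).+1]).
    exists [:: square (maxn x y).+1] => //=; constructor => //.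
    by apply: sqF; exists (maxn x y).+1.
  apply: (@sub_join _ (square (maxn x y).+1)); first by left.
  by split; rewrite /= ltnS ?leq_maxl ?leq_maxr.
Qed.

Lemma equivalence_omega_sub E R : equivalence_set E -> E_omega R -> E `<=` R ->
  E_omega E.
Proof.
move=> Eeq [_ [n Rn]] ER; apply: (equivalence_omega (n := n)) => // x.
by apply: card_le_trans (Rn x).1; apply: subset_card_le; exact: xsection_sub.
Qed.

Lemma joinable_squares : joinable (range square).
Proof.
move=> _ [l lsq <-].
have [N lN] : exists N, forall F, List.In F l -> F `<=` square N.
  elim: lsq => [|_ {}l [n _ <-] _ [N lN]]; first by exists 0.
  exists (maxn n N) => F [<-|/lN FN] p; last move/FN.
    by move=> [/= p1 p2]; split=> /=; rewrite leq_max ?p1 ?p2.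
  by move=> [/= p1 p2]; split=> /=; rewrite leq_max ?p1 ?p2 orbT.
pose R := [set p : nat * nat | p.1 = p.2 \/ square N p].
have Req : equivalence_set R.
  split=> [x|x y|x y z]; first by left.
    by move=> [/= ->|[/= xN yN]]; [left|right].
  move=> [/= ->//|[/= xN yN]] [/= <-|[/= _ zN]]; by right.
apply: (equivalence_omega_sub (join_equivalence l) (R := R)); last first.
  by apply: join_min => // F Fl p /(lN _ Fl); right.
apply: (equivalence_omega (n := N.+1)) => // x.
have [xN|Nx] := ltnP x N.
  apply: subset_card_le => y /xsectionP[/= <-|[_ /= yN]] /=; exact: ltnW.
apply: (inj_on_card_le (f := fun=> 0)) => // y z /xsectionP Ry /xsectionP Rz _.
have h w : R (x, w) -> x = w by case=> // -[/=]; rewrite ltnNge Nx.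
by rewrite -(h _ Ry) -(h _ Rz).
Qed.

(** * Gluing points of a discrete set *)

Definition clash (E : set (nat * nat)) (A : set nat) :=
  [set x | A x /\ exists y, [/\ A y, y <> x & E (x, y)]].

Lemma discrete_clash CC A E : CC `<=` E_omega1 -> coarse_discrete CC A ->
  CC E -> finite_set (clash E A).
Proof.
move=> CE Adisc CE_E; apply: sub_finite_set (bounded_finite CE (Adisc _ CE_E)).
move=> x [Ax xy]; split=> //; apply/section_neq1P => //.
by have [+ _] := CE _ CE_E; apply.
Qed.

(** Exchanges the two members of each pair 2i, 2i + 1. *)
Definition swap k := if odd k then k.-1 else k.+1.

Lemma odd_swap k : odd (swap k) = ~~ odd k.
Proof.
by case: k => [|k] //; rewrite /swap /=; case ok: (odd k) => /=; rewrite ok.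
Qed.

Lemma swapK : involutive swap.
Proof.
by case=> [|k] //; rewrite /swap /=; case ok: (odd k) => /=; rewrite ok.
Qed.

Lemma swap_neq k : swap k <> k.
Proof. by move=> /(congr1 odd); rewrite odd_swap; case: odd. Qed.

Lemma card_setU_II {T : Type} (A B : set T) m n :
  A #<= `I_m -> B #<= `I_n -> A `|` B #<= `I_(m + n).
Proof.
move=> /(card_le_inj_on 0)[f [fm finj]] /(card_le_inj_on 0)[g [gn ginj]].
pose h x := if pselect (A x) then f x else m + g x.
apply: (inj_on_card_le (f := h)) => [x ABx|x y ABx ABy]; rewrite /h.
  case: pselect => Ax /=; first exact/ltn_addr/fm.
  by rewrite ltn_add2l; apply: gn; case: ABx.
case: pselect => Ax; case: pselect => Ay.
- exact: finj.
- by move=> /= E; have := fm _ Ax; rewrite /= E ltnNge leq_addr.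
- by move=> /= E; have := fm _ Ay; rewrite /= -E ltnNge leq_addr.
- by move=> /addnI; apply: ginj; [case: ABx|case: ABy].
Qed.

Definition pairs (e : nat -> nat) : set (nat * nat) :=
  range (fun k => (e k, e (swap k))).

(** Away from the finite set K of points that clashes can influence, a cell
    of E contains at most one point e k, hence is glued to the cell of
    e (swap k) only; the set K is turned into a single cell. *)
Lemma glue_pairs E e : equivalence_set E -> E_omega E -> injective e ->
  finite_set (clash E (range e)) ->
  exists R, [/\ equivalence_set R, E_omega R, E `<=` R & pairs e `<=` R].
Proof.
move=> Eeq Eom einj; set Bad := clash E _ => Badfin.
have Erefl := equivalence_set_refl Eeq.
have Esym := equivalence_set_sym Eeq.
have Etr := equivalence_set_trans Eeq.
have [_ Efin] := E_omega_omega1 Eom.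
have /choice[phi phiE'] x : exists y,
    (forall k, x = e k -> y = e (swap k)) /\ (~ range e x -> y = x).
  have [[k _ <-]|n] := pselect (range e x); last first.
    by exists x; split=> // k xk; case: n; exists k.
  exists (e (swap k)); split=> [k' /einj ->//|]; by case; exists k.
have phiE k : phi (e k) = e (swap k) by have [h _] := phiE' (e k); exact: h.
pose K0 := thickening E Bad; pose K := K0 `|` thickening E (phi @` K0).
have thick_fin S : finite_set S -> finite_set (thickening E S).
  by move=> Sfin; apply: bigcup_finite => // x _; have [] := Efin x.
have K0fin : finite_set K0 by exact: thick_fin.
have Kfin : finite_set K.
  by rewrite finite_setU; split=> //; apply: thick_fin; exact: finite_image.
have Ksat x y : K x -> E (x, y) -> K y.
  move=> [/thickeningP[b bB bx]|/thickeningP[b bB bx]] xy; [left|right];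
    by apply/thickeningP; exists b => //; exact: Etr bx xy.
have uniq i j : E (e i, e j) -> ~ K (e i) -> i = j.
  move=> Eij nK; apply: contrapT => ij; apply: nK; left; apply/thickeningP.
  exists (e i) => //; split; first by exists i.
  by exists (e j); split=> // /einj/esym.
have Kswap k : K (e k) -> K (e (swap k)).
  have K0swap i : K0 (e i) -> K (e (swap i)).
    move=> K0i; right; apply/thickeningP; exists (e (swap i)) => //.
    by exists (e i).
  move=> [/K0swap//|/thickeningP[_ [c K0c <-] Eck]].
  have [[i _ ic]|nc] := pselect (range e c); last first.
    apply: K0swap; have [_ /(_ nc) cE] := phiE' c; rewrite cE in Eck.
    by have [b bB bc] := (thickeningP _ _ _).1 K0c; apply/thickeningP;
      exists b => //; exact: Etr bc Eck.
  move: Eck; rewrite -ic phiE => Eck; have [<-|ik] := pselect (swap i = k).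
    by rewrite swapK ic; left.
  apply: K0swap; apply/thickeningP; exists (e k) => //.
  split; first by exists k.
  by exists (e (swap i)); split=> //; [move=> /einj|exact: Esym].
pose linked x y := exists2 k, E (x, e k) & E (e (swap k), y).
pose R := [set p | (K p.1 /\ K p.2) \/
  [/\ ~ K p.1, ~ K p.2 & E p \/ linked p.1 p.2]].
have linked_sym x y : linked x y -> linked y x.
  move=> [k xk ky]; exists (swap k); first exact: Esym.
  by rewrite swapK; exact: Esym.
have Req : equivalence_set R.
  split=> [x|x y|x y z].
  - by have [Kx|nKx] := pselect (K x); [left|right; split=> //; left].
  - move=> [[Kx Ky]|[/= nKx nKy xy]]; first by left.
    by right; split=> //=; case: xy => [/Esym|/linked_sym]; [left|right].
  - move=> [[/= Kx Ky]|[/= nKx nKy xy]] [[/= Ky' Kz]|[/= nKy' nKz yz]] //.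
      by left.
    right; split=> //=.
    case: xy => [xy|[k xk ky]]; case: yz => [yz|[k' yk' k'z]].
    + by left; exact: Etr xy yz.
    + by right; exists k' => //; exact: Etr xy yk'.
    + by right; exists k => //; exact: Etr ky yz.
    (* Two consecutive links use the same pair in opposite directions. *)
    + left; apply: (Etr _ _ _ xk).
      have kk' : E (e (swap k), e k') by exact: Etr ky yk'.
      have <- : swap k' = k; last by [].
      rewrite -(uniq _ _ kk') ?swapK// => /Ksat /(_ ky); exact: nKy.
have ER : E `<=` R.
  move=> [x y] xy; have [Kx|nKx] := pselect (K x).
    by left; split=> //=; exact: Ksat Kx xy.
  by right; split=> //=; [move=> /Ksat /(_ (Esym _ _ xy))|left].
exists R; split=> //; last first.
  move=> _ [k _ <-]; have [Kk|nKk] := pselect (K (e k)).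
    by left; split=> //=; exact: Kswap.
  right; split=> //=; last by right; exists k.
  by move=> /Kswap; rewrite swapK.
have [m Km] := (finite_set_leP K).1 Kfin; have [_ [n En]] := Eom.
apply: (equivalence_omega (n := m + (n + n))) => // x.
have [Kx|nKx] := pselect (K x).
  apply: (@card_le_trans _ _ _ `I_m); last by rewrite card_le_II leq_addr.
  apply: card_le_trans Km; apply: subset_card_le => y /xsectionP[[]//|[]//].
apply: (@card_le_trans _ _ _ `I_(n + n)); last by rewrite card_le_II leq_addl.
have [[k xk]|nxk] := pselect (exists k, E (x, e k)).
  apply: card_le_trans (card_setU_II (En x).1 (En (e (swap k))).1).
  apply: subset_card_le => y /xsectionP[[]//|[_ _ /= [xy|[k' xk' k'y]]]].
    by left; exact/xsectionP.
  right; apply/xsectionP; rewrite (uniq k k') //.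
    exact: Etr (Esym _ _ xk) xk'.
  by move=> /Ksat /(_ (Esym _ _ xk)); exact: nKx.
apply: (@card_le_trans _ _ _ `I_n); last by rewrite card_le_II leq_addl.
apply: card_le_trans (En x).1; apply: subset_card_le.
move=> y /xsectionP[[]//|[_ _ /= [xy|[k xk _]]]]; first exact/xsectionP.
by case: nxk; exists k.
Qed.

(** Only one new relation is added, so a join of members of the larger family
    lies in the result of gluing the pairs to a join of members of FF. *)
Lemma joinable_pairs FF e : joinable FF -> injective e ->
  (forall E, joins FF E -> finite_set (clash E (range e))) ->
  joinable (pairs e |` FF).
Proof.
move=> FFj einj FFe _ [l lF <-].
have [l' [l'F ll']] : exists l', List.Forall FF l' /\
    forall F, List.In F l -> F = pairs e \/ List.In F l'.
  elim: lF => [|F {}l FF_F _ [l' [l'F ll']]]; first by exists [::].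
  case: FF_F => [->|FF_F].
    by exists l'; split=> // G [<-|/ll']; [left|].
  exists (F :: l'); split; first by constructor.
  move=> G [<-|/ll'[->|Gl']]; [by right; left|by left|by right; right].
have Jl' : joins FF (join l') by exists l'.
have [R [Req Rom ER eR]] :=
  glue_pairs (join_equivalence l') (FFj _ Jl') einj (FFe _ Jl').
apply: (equivalence_omega_sub (join_equivalence l) Rom).
apply: join_min => // F /ll'[->//|Fl'].
by apply: subset_trans ER; exact: sub_join.
Qed.

Lemma chain_Forall {T : Type} (C : set (set T)) (l : seq T) :
  C !=set0 -> total_on C subset -> List.Forall (\bigcup_(X in C) X) l ->
  exists2 X, C X & List.Forall X l.
Proof.
move=> [X0 CX0] Ctot; elim=> [|x {}l [X CX Xx] _ [Y CY Yl]]; first by exists X0.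
have [XY|YX] := Ctot _ _ CX CY.
  by exists Y => //; constructor => //; exact: XY.
by exists X => //; constructor => //; apply: List.Forall_impl Yl; exact: YX.
Qed.

Lemma maximal_joinable : exists FF, [/\ range square `<=` FF, joinable FF
  & forall GG, FF `<=` GG -> joinable GG -> GG = FF].
Proof.
apply: Zorn_bigcup_above; first exact: joinable_squares.
move=> C CP C0 Ctot _ [l lC <-]; have [X CX Xl] := chain_Forall C0 Ctot lC.
by apply: (CP _ CX); exists l.
Qed.

(** A maximal joinable family generates an indiscrete structure: the pairs cut
    out of an infinite discrete set could be added to the family, so they
    belong to the structure, which contradicts discreteness. *)
Lemma indiscrete_omega : exists CC, [/\ CC `<=` E_omega, coarse_structure CC,
  indiscrete CC & cellular CC].
Proof.
have [FF [sqF FFj FFmax]] := maximal_joinable; have BBP := joins_base sqF.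
exists (coarse_gen (joins FF)).
have CEo : coarse_gen (joins FF) `<=` E_omega by exact: coarse_gen_sub_omega.
have CE : coarse_gen (joins FF) `<=` E_omega1.
  exact: subset_trans CEo E_omega_omega1.
have CCs := coarse_gen_structure BBP; have [BC _] := coarse_gen_base BBP.
split=> //; last exact: coarse_gen_cellular.
split; first exact/(unboundedP _ CE CCs)/infinite_nat.
move=> A Adisc; apply: contrapT.
move=> /(unboundedP _ CE CCs)/infinite_injection[e [einj eA]].
have FFe : (pairs e |` FF) = FF.
  apply: FFmax; first by move=> F; right.
  apply: joinable_pairs => // E JE.
  apply: sub_finite_set (discrete_clash CE Adisc (BC _ JE)).
  by move=> _ [[i _ <-] [_ [[j _ <-] ji Eij]]]; split=> //; exists (e j).
have Je : joins FF (join [:: pairs e]).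
  by exists [:: pairs e] => //; constructor => //; rewrite -FFe; left.
suff : infinite_set (clash (join [:: pairs e]) A).
  by apply; exact: discrete_clash CE Adisc (BC _ Je).
apply: (injection_infinite einj) => k; split=> //.
exists (e (swap k)); split=> //; first by move=> /einj/swap_neq.
by apply: (@sub_join _ (pairs e)); [left|exists k].
Qed.

(** * Inseparated structures of bounded geometry *)

(** The structure is pulled back along an enumeration of part of A; the
    pullback has too small a base to be indiscrete. *)
Lemma small_base_discrete BB A : cellular_base BB -> BB `<=` E_omega ->
  ~ (Delta_cell E_omega #<= BB) -> infinite_set A ->
  exists e : nat -> nat, [/\ injective e, forall n, A (e n)
    & forall E, BB E -> finite_set (clash E (range e))].
Proof.
move=> [BBeq BBdir BBcov] BBo BBsmall /infinite_injection[i [iinj iA]].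
pose pull (B : set (nat * nat)) := [set p : nat * nat | B (i p.1, i p.2)].
have DDP : cellular_base (pull @` BB).
  split.
  - move=> _ [B BBB <-]; have Beq := BBeq _ BBB.
    split=> [x|x y|x y z]; first exact: (equivalence_set_refl Beq).
      exact: (equivalence_set_sym Beq).
    exact: (equivalence_set_trans Beq).
  - move=> _ _ [B BBB <-] [C BC <-]; have [G [BG BsG CG]] := BBdir _ _ BBB BC.
    by exists (pull G); split; [exists G|move=> p /BsG|move=> p /CG].
  - move=> x y; have [B BBB Bxy] := BBcov (i x) (i y).
    by exists (pull B) => //; exists B.
have DDo : pull @` BB `<=` E_omega.
  move=> _ [B BBB <-]; have [_ [n Bn]] := BBo _ BBB.
  have [Deq _ _] := DDP.
  apply: (equivalence_omega (n := n)) => [|x]; first by apply: Deq; exists B.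
  apply: card_le_trans (Bn (i x)).1.
  apply: (inj_on_card_le (f := i)) => [y /xsectionP Bxy|y z _ _ /iinj//].
  exact/xsectionP.
have CEo := coarse_gen_sub_omega DDo.
have CE := subset_trans CEo E_omega_omega1.
have CCs := coarse_gen_structure DDP; have [DC _] := coarse_gen_base DDP.
have [D [Ddisc Dunb]] : exists D, coarse_discrete (coarse_gen (pull @` BB)) D /\
    ~ coarse_bounded (coarse_gen (pull @` BB)) D.
  apply: contrapT => nD; apply: BBsmall.
  apply: card_le_trans (card_image_le pull BB).
  apply: card_le_trans (weight_le (coarse_gen_base DDP)).
  apply: min_weight_le => //; last exact: coarse_gen_cellular.
  split; first exact/(unboundedP _ CE CCs)/infinite_nat.
  by move=> D Ddisc; apply: contrapT => Dunb; apply: nD; exists D.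
have [d [dinj dD]] := infinite_injection ((unboundedP _ CE CCs).1 Dunb).
exists (i \o d); split=> [m n /iinj/dinj//|n|B BBB]; first exact: iA.
have DB : (pull @` BB) (pull B) by exists B.
have := finite_image i (discrete_clash CE Ddisc (DC _ DB)).
apply: sub_finite_set => _ [[m _ <-] [_ [[n _ <-] nm Bmn]]].
exists (d m) => //; split=> //; exists (d n); split=> // dnm.
by apply: nm; rewrite /= dnm.
Qed.

(** Any two infinite sets A and B can be glued along an infinite discrete set
    chosen half from A and half from B, unless they already fail to be
    separated. *)
Lemma joinable_unseparate FF A B : range square `<=` FF -> joinable FF ->
  ~ (Delta_cell E_omega #<= joins FF) -> infinite_set A -> infinite_set B ->
  exists F, joinable (F |` FF) /\ exists2 l, List.Forall (F |` FF) l &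
    infinite_set (thickening (join l) A `&` thickening (join l) B).
Proof.
move=> sqF FFj FFsmall Ainf Binf.
have [[l lF linf]|sep] := pselect (exists2 l, List.Forall FF l &
    infinite_set (thickening (join l) A `&` thickening (join l) B)).
  have F0 : FF (square 0) by apply: sqF; exists 0.
  have FF0 : (square 0 |` FF) = FF.
    by apply/seteqP; split=> [F [->|]|F FF_F]; [..|right].
  by exists (square 0); rewrite FF0; split=> //; exists l.
have sepE E : joins FF E -> finite_set (thickening E A `&` thickening E B).
  by move=> [l lF <-]; apply: contrapT => linf; apply: sep; exists l.
have BBP := joins_base sqF; have [BBeq _ _] := BBP.
have Jnil : joins FF (join [::]) by exists [::].
have ABfin : finite_set (A `&` B).
  apply: sub_finite_set (sepE _ Jnil) => x [Ax Bx].
  by split; apply/thickeningP; exists x => //;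
    exact: (equivalence_set_refl (BBeq _ Jnil)).
(* Points of A are taken outside B to make the merged sequence e injective. *)
have A'inf : infinite_set (A `\` B).
  move=> ABinf; apply: Ainf.
  apply: (@sub_finite_set _ _ ((A `&` B) `|` (A `\` B))).
    by move=> x Ax; have [Bx|nBx] := pselect (B x); [left|right].
  by rewrite finite_setU.
have [a [ainj aA aE]] := small_base_discrete BBP FFj FFsmall A'inf.
have [b [binj bB bE]] := small_base_discrete BBP FFj FFsmall Binf.
pose e k := if odd k then b k./2 else a k./2.
have eodd k : e k.*2.+1 = b k by rewrite /e /= odd_double /= uphalf_double.
have eeven k : e k.*2 = a k by rewrite /e odd_double doubleK.
have einj : injective e.
  move=> j k; rewrite /e.
  have jE := odd_double_half j; have kE := odd_double_half k.
  case: (odd j) jE; case: (odd k) kE => kE jE E.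
  - by rewrite -jE -kE (binj _ _ E).
  - by have [_ []] := aA k./2; rewrite -E; exact: bB.
  - by have [_ []] := aA j./2; rewrite E; exact: bB.
  - by rewrite -jE -kE (ainj _ _ E).
exists (pairs e); split.
  apply: joinable_pairs => // E JE; have Eeq := BBeq _ JE.
  have Erefl := equivalence_set_refl Eeq; have Esym := equivalence_set_sym Eeq.
  pose S := thickening E A `&` thickening E B.
  apply: (@sub_finite_set _ _ (clash E (range a) `|` clash E (range b) `|` S)).
    move=> _ [[i _ <-] [_ [[j _ <-]]]]; rewrite /e.
    have aA' k : A (a k) by have [] := aA k.
    case: (odd i); case: (odd j) => neq Eij.
    - by left; right; split=> //; exists (b j./2); split=> //; exists j./2.
    - right; split; apply/thickeningP; last by exists (b i./2).
      by exists (a j./2) => //; exact: Esym.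
    - right; split; apply/thickeningP; first by exists (a i./2).
      by exists (b j./2) => //; exact: Esym.
    - by left; left; split=> //; exists (a j./2); split=> //; exists j./2.
  by rewrite !finite_setU; split; [split; [exact: aE|exact: bE]|exact: sepE].
exists [:: pairs e]; first by constructor => //; left.
have Eeq := join_equivalence [:: pairs e].
apply: (injection_infinite ainj) => k; split; apply/thickeningP.
  by exists (a k); [have [] := aA k|exact: (equivalence_set_refl Eeq)].
exists (b k) => //; apply: (@sub_join _ (pairs e)); first by left.
by exists k.*2.+1 => //; rewrite /swap /= odd_double /= eodd eeven.
Qed.

Definition stage {I : Type} (F : I -> set (nat * nat)) (J : set I) :=
  range square `|` F @` J.

(** A join involves finitely many relations, and these already occur together at
    the successor stage of some i in J, unless J is empty. *)
Lemma joinable_stage {I : Type} (R : I -> I -> Prop)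
    (F : I -> set (nat * nat)) (J : set I) : strict_well_order R ->
  (forall i, J i -> joinable (F i |` stage F [set j | R j i])) ->
  joinable (stage F J).
Proof.
move=> Rwo Jj; have [Rwf Rtr Rtri] := Rwo.
have [J0|/set0P[i0 Ji0]] := eqVneq J set0.
  by rewrite /stage J0 image_set0 setU0; exact: joinable_squares.
pose C := [set F i |` stage F [set j | R j i] | i in J].
have CJ : stage F J `<=` \bigcup_(X in C) X.
  move=> G [sqG|[i Ji <-]].
    by exists (F i0 |` stage F [set j | R j i0]); [exists i0|right; left].
  by exists (F i |` stage F [set j | R j i]); [exists i|left].
move=> _ [l lJ <-].
have [|||X [i Ji <-] lX] := @chain_Forall _ C l.
- by exists (F i0 |` stage F [set j | R j i0]); exists i0.
- have mono i j : R i j ->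
      (F i |` stage F [set k | R k i]) `<=` (F j |` stage F [set k | R k j]).
    move=> ij G [->|[sqG|[k ki <-]]]; right; [by right; exists i|by left|].
    by right; exists k => //; exact: Rtr ki ij.
  move=> _ _ [i Ji <-] [j Jj' <-].
  by have [/mono|->|/mono] := Rtri i j; [left|left|right].
- exact: List.Forall_impl lJ.
- by apply: (Jj _ Ji); exists l.
Qed.

(** There are no more finite lists over an infinite set of relations than
    relations.  So if J is infinite, stage J has at most as many joins as J has
    elements, and if J is finite, it has countably many. *)
Lemma card_joins_stage {I : Type} (F : I -> set (nat * nat)) (J : set I) :
  [set: I] #<= continuum -> ~ ([set: I] #<= J) -> continuum #<= [set: I] ->
  ~ (continuum #<= joins (stage F J)).
Proof.
move=> Ic IJ cI cJ.
have small T (A : set T) : infinite_set A -> J #<= A -> continuum #<= A.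
  move=> Ainf JA; apply: card_le_trans cJ _.
  apply: card_le_trans (card_image_le _ _) _; apply: card_le_seq => //.
  apply: card_le_setU => //; last exact: card_le_trans (card_image_le _ _) JA.
  by apply: card_le_trans (card_image_le _ _) _; exact/infiniteP.
have [Jfin|Jinf] := pselect (finite_set J).
  apply: (Cantor_card 0); apply: small; first exact: infinite_nat.
  exact: finite_set_countable.
by apply: IJ; apply: card_le_trans Ic _; exact: small.
Qed.

(** All pairs (A, B) are well-ordered with initial segments smaller than c, so
    that each stage has fewer than c generators and [joinable_unseparate]
    applies to the pair treated there. *)
Lemma inseparated_omega : Delta_cell E_omega #= continuum ->
  exists CC, [/\ CC `<=` E_omega, coarse_structure CC, inseparated CC
                 & cellular CC].
Proof.
rewrite card_eq_le => /andP[_ cD].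
pose I := (set nat * set nat)%type.
have cinf : infinite_set continuum.
  apply: (@injection_infinite _ _ set1) => // m n.
  by move=> /seteqP[/(_ m erefl)].
have Ic : [set: I] #<= continuum.
  by rewrite -[[set: I]]setXTT; apply: card_le_setX => //; exact: card_lexx.
have cI : continuum #<= [set: I].
  by apply: (inj_on_card_le (f := fun A => (A, A))) => // A B _ _ [].
have [R [Rwo Rsmall]] := exists_initial_well_order I.
have [Rwf _ _] := Rwo.
pose below i := [set j | R j i].
pose Q (i : I) (F : I -> set (nat * nat)) (v : set (nat * nat)) :=
  joinable (stage F (below i)) -> joinable (v |` stage F (below i)) /\
  (infinite_set i.1 -> infinite_set i.2 ->
   exists2 l, List.Forall (v |` stage F (below i)) l &
     infinite_set (thickening (join l) i.1 `&` thickening (join l) i.2)).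
have [||F FQ] := @transfinite_choice _ _ R Q set0 Rwo.
- move=> i F F' v FF'; rewrite /Q.
  suff -> : stage F (below i) = stage F' (below i) by [].
  congr (_ `|` _).
  by apply/seteqP; split=> _ [j ji <-]; exists j => //; rewrite FF'.
- move=> [A B] F _.
  set S := stage F (below (A, B)).
  have [jn|] := pselect (joinable S); last by exists set0.
  have sm : ~ (Delta_cell E_omega #<= joins S).
    by move=> /(card_le_trans cD); exact: (card_joins_stage Ic (Rsmall _) cI).
  have sq0 : (square 0 |` S) = S.
    by apply/seteqP; split=> [G [->|//]|G]; [left; exists 0|right].
  have [[Ainf Binf]|nAB] := pselect (infinite_set A /\ infinite_set B).
    have [|G [Gj Gl]] := joinable_unseparate _ jn sm Ainf Binf.
      by move=> ? ?; left.
    by exists G.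
  by exists (square 0) => _; rewrite sq0; split=> // Ainf Binf; case: nAB.
have below_joinable i : joinable (stage F (below i)).
  elim/(well_founded_ind Rwf): i => i IH; apply: (joinable_stage Rwo) => j ji.
  by have [] := FQ j (IH _ ji).
have allj : joinable (stage F setT).
  by apply: (joinable_stage Rwo) => j _; have [] := FQ j (below_joinable j).
have BBP : cellular_base (joins (stage F setT)) by apply: joins_base => G; left.
have CEo := coarse_gen_sub_omega allj.
have CE := subset_trans CEo E_omega_omega1.
have CCs := coarse_gen_structure BBP; have [BC _] := coarse_gen_base BBP.
exists (coarse_gen (joins (stage F setT))).
split=> //; last exact: coarse_gen_cellular.
split; first exact/(unboundedP _ CE CCs)/infinite_nat.
move=> [A [B [/(unboundedP _ CE CCs) Ainf /(unboundedP _ CE CCs) Binf sep]]].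
have [_ /(_ Ainf Binf)[l lF]] := FQ (A, B) (below_joinable _).
apply; apply: (bounded_finite CE); apply: sep; apply: BC; exists l => //=.
apply: List.Forall_impl lF => G [->|[|[j _ <-]]].
- by right; exists (A, B).
- by left.
- by right; exists j.
Qed.

Theorem theorem5p2 :
  [/\ Lambda_cell E_omega #= card_succ continuum,
      Delta_cell E_omega #<= continuum,
      Delta_cell E_omega #= continuum ->
        Sigma_cell E_omega1 #<= Sigma_cell E_omega /\
        Sigma_cell E_omega #= continuum,
      t_card #= b_card ->
        Delta_cell E_omega1 #= Sigma_cell E_omega1 /\
        Sigma_cell E_omega1 #= b_card
    & t_card #= d_card -> Lambda_cell E_omega1 #= d_card].
Proof.
have weight_continuum (CC : set (set (nat * nat))) : weight CC #<= continuum.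
  exact: card_le_trans (card_leT _) card_set_prod_nat.
have Delta_Sigma EE : EE `<=` E_omega1 -> Delta_cell EE #<= Sigma_cell EE.
  move=> EE1; apply: min_weight_mono => // CC CE CCs CCc.
  by apply: inseparated_indiscrete => //; exact: subset_trans EE1.
split.
- have [//|[CC [CE CCs CClarge CCc _]]] := min_weight_cases large E_omega.
  by have := no_large_omega CE CCs CCc CClarge.
- have [CC [CE CCs CCi CCc]] := indiscrete_omega.
  exact: card_le_trans (min_weight_le CE CCs CCi CCc) (weight_continuum _).
- move=> Dc; split.
    by apply: min_weight_mono => //; exact: E_omega_omega1.
  have [CC [CE CCs CCi CCc]] := inseparated_omega Dc.
  rewrite card_eq_le; apply/andP; split.
    exact: card_le_trans (min_weight_le CE CCs CCi CCc) (weight_continuum _).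
  rewrite -(card_le_eql Dc); exact: Delta_Sigma E_omega_omega1.
- move=> tb; have [CC [CE CCs CCi CCc CCb]] := b_structure tb.
  have Sb : Sigma_cell E_omega1 #<= b_card.
    exact: card_le_trans (min_weight_le CE CCs CCi CCc) CCb.
  have DS : Delta_cell E_omega1 #<= Sigma_cell E_omega1 by exact: Delta_Sigma.
  have bD : b_card #<= Delta_cell E_omega1.
    apply: le_min_weight b_le_continuum _ => CC' CE' CCs' CCi' _.
    exact: b_le_weight.
  split; rewrite card_eq_le; apply/andP; split=> //.
    exact: card_le_trans Sb bD.
  exact: card_le_trans bD DS.
- move=> td; have [CC [CE CCs CCl CCc CCd]] := d_structure td.
  rewrite card_eq_le; apply/andP; split.
    exact: card_le_trans (min_weight_le CE CCs CCl CCc) CCd.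
  apply: le_min_weight d_le_continuum _ => CC' CE' CCs' CCl' _.
  exact: d_le_weight.
Qed.
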